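(* Let $\phi,\varphi:[0,\infty)\to[0,\infty)$, where $\phi$ is convex, monotonically increasing and satisfies $\phi(xy)\le\varphi(x)\phi(y)$ for all $x,y\ge 0$. Let $p,q\in\mathcal{P}(\mathbb{R})$ with $1/p(x)+1/q(x)=1$, let $F:(0,\infty)\times\mathbb{R}\to(0,\infty)$, let $\psi\in L^1(\mathbb{R})$, and let $(a_k)_{k\in\mathbb{Z}}$ be a sequence of positive real numbers with $\sum_{k\in\mathbb{Z}}a_k=1$. Let $f\in L^\infty(\mathbb{R}:X)$ be equi-Weyl-$(p,\phi,F)$-almost periodic [respectively, Weyl-$(p,\phi,F)$-almost periodic]. Then the function $$x\mapsto(\psi*f)(x):=\int_{-\infty}^{+\infty}\psi(x-y)f(y)\,dy,\quad x\in\mathbb{R},$$ is well-defined and belongs to $L^\infty(\mathbb{R}:X)$. Furthermore, if $p_1\in\mathcal{P}(\mathbb{R})$, $F_1:(0,\infty)\times\mathbb{R}\to(0,\infty)$ and if for every $t\in\mathbb{R}$ and $l>0$ $$\int_t^{t+l}\varphi_{p_1(x)}\Biggl(2l^{-1}F_1(l,t)\,\varphi(l)\sum_{k\in\mathbb{Z}}\frac{a_k\bigl\|\varphi\bigl(a_k^{-1}|\psi(x-z)|\bigr)\bigr\|_{L^{q(z)}[x-(k+1)l,x-kl]}}{F(l,x-(k+1)l)}\Biggr)\,dx\le1 ,$$ then $\psi*f$ is equi-Weyl-$(p_1,\phi,F_1)$-almost periodic [respectively, Weyl-$(p_1,\phi,F_1)$-almost periodic].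
   Context: $X$ is a complex Banach space. For $\Omega\subseteq\mathbb{R}$, $\mathcal{P}(\Omega)$ is the set of Lebesgue measurable $p:\Omega\to[1,\infty]$ (with $1/\infty=0$). For $t\ge 0$: $\varphi_{p(x)}(t)=t^{p(x)}$ if $p(x)<\infty$; if $p(x)=\infty$, $\varphi_{p(x)}(t)=0$ for $0\le t\le 1$ and $\varphi_{p(x)}(t)=\infty$ for $t>1$. (The indexed $\varphi_{p(x)}$ is not related to the function $\varphi$.) A measurable $u$ on $\Omega$ belongs to $L^{p(x)}(\Omega)$ iff $\int_\Omega\varphi_{p(x)}(\lambda\|u(x)\|)dx<\infty$ for some $\lambda>0$, and $\|u\|_{L^{p(\cdot)}(\Omega)}=\inf\{\lambda>0:\int_\Omega\varphi_{p(x)}(\|u(x)\|/\lambda)\,dx\le 1\}$. On subintervals the restriction of $p$ is used; in $\|\cdot\|_{L^{q(z)}[a,b]}$ the variable is $z$. Let $p\in\mathcal{P}(\mathbb{R})$, $\phi:[0,\infty)\to[0,\infty)$, $F:(0,\infty)\times\mathbb{R}\to(0,\infty)$, and let $f:\mathbb{R}\to X$ be such that $\phi(\|f(\cdot+\tau)-f(\cdot)\|)\in L^{p(x)}(K)$ for every $\tau\in\mathbb{R}$ and compact $K\subseteq\mathbb{R}$. Then $f$ is: - equi-Weyl-$(p,\phi,F)$-almost periodic iff for each $\epsilon>0$ there are $l>0$, $L>0$ such that every interval $I'\subseteq\mathbb{R}$ of length $L$ contains $\tau$ with $\sup_{t\in\mathbb{R}}F(l,t)\,\bigl\|\phi(\|f(\cdot+\tau)-f(\cdot)\|)\bigr\|_{L^{p(\cdot)}[t,t+l]}\le\epsilon$;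 - Weyl-$(p,\phi,F)$-almost periodic iff for each $\epsilon>0$ there is $L>0$ such that every interval $I'\subseteq\mathbb{R}$ of length $L$ contains $\tau$ with $\limsup_{l\to\infty}\sup_{t\in\mathbb{R}}F(l,t)\,\bigl\|\phi(\|f(\cdot+\tau)-f(\cdot)\|)\bigr\|_{L^{p(\cdot)}[t,t+l]}\le\epsilon$. *)

(* Defs.v *)
From HB Require Import structures.
From mathcomp Require Import all_boot all_order all_algebra.
From mathcomp Require Import complex.
From mathcomp Require Import all_classical all_reals all_analysis.
From mathcomp Require Import measurable_realfun.
Set Implicit Arguments.
Unset Strict Implicit.
Unset Printing Implicit Defensive.
Import Order.TTheory GRing.Theory Num.Theory.
Import numFieldNormedType.Exports.
Local Open Scope complex_scope.
Local Open Scope classical_set_scope.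
Local Open Scope ring_scope.

(* R with the sigma-algebra of Lebesgue (= Caratheodory) measurable sets.  The
   library's [lebesgue_measure] lives on the Borel sets, which would be too
   restrictive for "Lebesgue measurable" exponents and functions. *)
Notation lebesgueType R := (caratheodory_type ((@wlength R idfun)^*)%mu).
Notation leb R := (@completed_lebesgue_measure R).

(* The norm of a complex normed space takes its values in R[i]. *)
Definition rnorm (R : realType) (V : normedModType R[i]) (x : V) : R :=
  complex.Re `|x|.

Section bochner.
Variables (R : realType) (X : completeNormedModType R[i]).
Local Notation mu := (leb R).
Implicit Types (f : R -> X) (v : X).

Definition simple_function (s : R -> X) :=
  finite_set (range s) /\
  forall c : X, c != 0 ->
    measurable (s @^-1` [set c] : set (lebesgueType R)) /\
    (mu (s @^-1` [set c]) < +oo)%E.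

(* The value c = 0, whose level set has infinite measure, contributes 0. *)
Definition simple_integral (s : R -> X) : X :=
  \sum_(c \in range s) (fine (mu (s @^-1` [set c])))%:C *: c.

Definition simple_approx f (s : nat -> R -> X) :=
  (forall n, simple_function (s n)) /\
  {ae mu, forall x, s n x @[n --> \oo] --> f x}.

Definition strongly_measurable f := exists s : nat -> R -> X, simple_approx f s.

Definition is_bochner_integral f v :=
  exists s : nat -> R -> X,
    [/\ simple_approx f s,
        (\int[mu]_x (rnorm (f x - s n x))%:E)%E @[n --> \oo] --> 0%E &
        simple_integral (s n) @[n --> \oo] --> v].

Definition bochner_integral f : X := xget 0 [set v | is_bochner_integral f v].

Definition Linfty f :=
  strongly_measurable f /\
  exists M : R, {ae mu, forall x, rnorm (f x) <= M}.

Definition convolution (psi : R -> R[i]) f (x : R) : X :=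
  bochner_integral (fun y => psi (x - y) *: f y).

End bochner.

Definition complex_L1 (R : realType) (psi : R -> R[i]) :=
  (leb R).-integrable setT (fun x => (complex.Re (psi x))%:E) /\
  (leb R).-integrable setT (fun x => (complex.Im (psi x))%:E).

Section variable_exponent.
Variable R : realType.
Implicit Types (p : R -> \bar R) (D : set R) (u : R -> R).

Definition exponent p :=
  measurable_fun [set: lebesgueType R] (p : lebesgueType R -> \bar R) /\ forall x, (1 <= p x)%E.

(* Extended to t = +oo by the value +oo, since the argument of the modular in
   the main hypothesis may be infinite. *)
Definition phi_exp (r t : \bar R) : \bar R :=
  if r is s%:E then poweR t s else if (t <= 1)%E then 0%E else +oo%E.

Definition in_Lp p D u :=
  measurable_fun (D : set (lebesgueType R)) (u : lebesgueType R -> R) /\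
  exists2 lam : R, 0 < lam &
    (\int[leb R]_(x in D) phi_exp (p x) (lam * `|u x|)%:E < +oo)%E.

(* +oo when the set of admissible lambda is empty, i.e. outside L^p(D). *)
Definition Lp_norm p D u : \bar R :=
  ereal_inf [set lam%:E | lam in [set lam : R | 0 < lam /\
    (\int[leb R]_(x in D) phi_exp (p x) (`|u x| / lam)%:E <= 1)%E]].

End variable_exponent.

Definition nneg_map (R : realType) (phi : R -> R) :=
  forall x, 0 <= x -> 0 <= phi x.

Definition pos_weight (R : realType) (F : R -> R -> R) :=
  forall l t, 0 < l -> 0 < F l t.

Section weyl.
Variables (R : realType) (X : completeNormedModType R[i]).
Variables (p : R -> \bar R) (phi : R -> R) (F : R -> R -> R) (f : R -> X).

Definition phi_diff (tau x : R) : R := phi (rnorm (f (x + tau) - f x)).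

Definition diff_locally_Lp :=
  forall (tau : R) (K : set R), compact K -> in_Lp p K (phi_diff tau).

Definition weyl_sup (tau l : R) : \bar R :=
  ereal_sup [set ((F l t)%:E * Lp_norm p `[t, (t + l)%R] (phi_diff tau))%E
            | t in [set: R]].

Definition equi_weyl_ap :=
  diff_locally_Lp /\
  forall eps : R, 0 < eps -> exists l L : R, [/\ 0 < l, 0 < L &
    forall I : set R, is_interval I -> leb R I = L%:E ->
      exists2 tau, I tau & (weyl_sup tau l <= eps%:E)%E].

Definition weyl_ap :=
  diff_locally_Lp /\
  forall eps : R, 0 < eps -> exists2 L : R, 0 < L &
    forall I : set R, is_interval I -> leb R I = L%:E ->
      exists2 tau, I tau & (limf_esup (weyl_sup tau) +oo%R <= eps%:E)%E.

End weyl.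

(* The norms are allowed to be +oo, with 0 * +oo = 0; for a non-measurable
   nonnegative integrand the library integral is the lower integral. *)
Section kernel.
Variables (R : realType) (psi : R -> R[i]) (a : int -> R) (vphi : R -> R).
Variables (q p1 : R -> \bar R) (F F1 : R -> R -> R).

Definition kernel_norm (l x : R) (k : int) : \bar R :=
  Lp_norm q `[x - (k%:~R + 1) * l, x - k%:~R * l]
    (fun z => vphi ((a k)^-1 * rnorm (psi (x - z) : R[i]^o))).

Definition kernel_sum (l x : R) : \bar R :=
  (\esum_(k in [set: int])
    ((a k)%:E * kernel_norm l x k / (F l (x - (k%:~R + 1) * l))%:E))%E.

Definition kernel_bound :=
  forall t l : R, 0 < l ->
    (\int[leb R]_(x in `[t, (t + l)%R])
       phi_exp (p1 x)
         ((2 * l^-1 * F1 l t * vphi l)%:E * kernel_sum l x) <= 1)%E.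

End kernel.

(* Main.v *)
Require Import Defs.
From HB Require Import structures.
From mathcomp Require Import all_boot all_order all_algebra.
From mathcomp Require Import complex.
From mathcomp Require Import finmap.
From mathcomp Require Import all_classical all_reals all_analysis.
From mathcomp Require Import measurable_realfun.
From mathcomp Require Import ring lra.
Import Order.TTheory GRing.Theory Num.Theory.
Import numFieldNormedType.Exports.
Local Open Scope complex_scope.
Local Open Scope classical_set_scope.
Local Open Scope ring_scope.

(** Let [g] be the convolution of [psi] and [f].  By translation invariance
    [g (x + tau) - g x] is the integral over [y] of [psi (x - y)] times
    [f (y + tau) - f y], so its norm is at most the integral of [w * N], where
    [w y] and [N y] are the norms of these two factors.  Cut the line into the
    blocks [I k] from [x - (k + 1) l] to [x - k l].  The density equal to
    [a k / l] on [I k] has total mass 1, and the integral of [w * N] is [l]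
    times the mean, for this density, of the function equal to
    [(a k)^-1 * w * N] on [I k].  Apply [phi].  Submultiplicativity takes out
    [vphi l]; Jensen's inequality ([jensen_blocks]) moves [phi] inside the mean;
    submultiplicativity again bounds [phi ((a k)^-1 * w * N)] by
    [vphi ((a k)^-1 * w) * phi N]; and Hoelder's inequality with constant 2
    ([hoelder_Lp_norm]) bounds the integral of this product over [I k] by twice
    the product of an L^q norm, the one in the kernel sum, and of the L^p norm
    of [phi N], which is at most [eps / F l (x - (k + 1) l)] as soon as [tau] is
    an [eps]-period of [f] at scale [l].  Summing up, [phi] of the norm of
    [g (x + tau) - g x] is at most [eps] times [vphi l], [2 / l] and the kernel
    sum ([phi_convolution_diff]), and the bound assumed on the modular of the
    kernel sum says precisely that [tau] is then an [eps]-period of [g] at the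
    same scale [l] ([weyl_sup_convolution]).  Both notions of almost periodicity
    follow, since neither the period nor the scale has changed.

    As [vphi] is arbitrary, the functions under the L^q norms and the kernel sum
    need not be measurable, and their integrals are lower integrals.  These are
    still monotone ([le_lower_integral]), and Hoelder's inequality is applied to
    a measurable minorant instead.

    That [g] is well defined and in L^oo rests on the Bochner integral: it is
    unique and contracting because the integral of simple functions is additive
    ([simple_integral_comp]), and it exists for strongly measurable functions of
    integrable norm by dominated convergence ([simple_approx_L1]).  Strong
    measurability of [g] follows from its continuity, that is, from continuity
    of translation in L1 ([integrable_L1_continuous]). *)

Set Implicit Arguments.
Unset Strict Implicit.
Unset Printing Implicit Defensive.

(** * Real-valued norms *)

Section rnorm.
Variables (R : realType) (V : normedModType R[i]).
Implicit Types x y : V.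

Lemma norm_rnorm x : `|x| = (rnorm x)%:C.
Proof. by rewrite /rnorm RRe_real// normr_real. Qed.

Lemma rnorm_ge0 x : 0 <= rnorm x.
Proof. by have := normr_ge0 x; rewrite norm_rnorm ler0c. Qed.

Lemma rnorm0 : rnorm (0 : V) = 0.
Proof. by rewrite /rnorm normr0. Qed.

Lemma rnorm0_eq0 x : rnorm x = 0 -> x = 0.
Proof. by move=> x0; apply/eqP; rewrite -normr_eq0 norm_rnorm x0. Qed.

Lemma rnormN x : rnorm (- x) = rnorm x.
Proof. by rewrite /rnorm normrN. Qed.

Lemma rnorm_distC x y : rnorm (x - y) = rnorm (y - x).
Proof. by rewrite /rnorm distrC. Qed.

Lemma rnormD x y : rnorm (x + y) <= rnorm x + rnorm y.
Proof. by rewrite -lecR -norm_rnorm rmorphD/= -!norm_rnorm ler_normD. Qed.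

Lemma rnormB x y : rnorm (x - y) <= rnorm x + rnorm y.
Proof. by rewrite -(rnormN y) rnormD. Qed.

Lemma ler_dist_rnorm x y : `|rnorm x - rnorm y| <= rnorm (x - y).
Proof.
rewrite ler_norml; apply/andP; split.
  rewrite lerBrDl lerBlDr rnorm_distC addrC -lerBlDr lerBlDl.
  by rewrite -{1}[y](subrK x) addrC rnormD.
by rewrite lerBlDr -{1}[x](subrK y) rnormD.
Qed.

Lemma rnormZ (a : R[i]) x : rnorm (a *: x) = rnorm (a : R[i]^o) * rnorm x.
Proof.
apply: (@complexI R); rewrite -norm_rnorm rmorphM/= -norm_rnorm normrZ.
by congr (_ * _); rewrite /rnorm RRe_real// normr_real.
Qed.

Lemma rnorm_real (a : R) : rnorm (a%:C : R[i]^o) = `|a|.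
Proof. by rewrite /rnorm normc_def/= expr0n addr0 sqrtr_sqr. Qed.

Lemma cvg_rnormP (s : nat -> V) (l : V) :
  s @ \oo --> l <-> rnorm (l - s n) @[n --> \oo] --> (0 : R).
Proof.
split=> [/cvgrPdist_lt sl|/cvgrPdist_lt sl]; apply/cvgrPdist_lt => e e0.
  have := sl e%:C; rewrite ltcR => /(_ e0); apply: filterS => n.
  by rewrite norm_rnorm ltcR sub0r normrN ger0_norm// rnorm_ge0.
have e0' : 0 < complex.Re e by move: e0; rewrite ltcE => /andP[].
have eE : e = (complex.Re e)%:C by rewrite RRe_real// gtr0_real.
have := sl _ e0'; apply: filterS => n.
by rewrite sub0r normrN ger0_norm ?rnorm_ge0// norm_rnorm {2}eE ltcR.
Qed.

Lemma cvg_rnorm (s : nat -> V) (l : V) :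
  s @ \oo --> l -> rnorm (s n) @[n --> \oo] --> rnorm l.
Proof.
move=> /cvg_rnormP sl; apply/cvgrPdist_lt => e e0.
move/cvgrPdist_lt : sl => /(_ e e0); apply: filterS => n.
rewrite sub0r normrN ger0_norm ?rnorm_ge0//.
by apply: le_lt_trans; exact: ler_dist_rnorm.
Qed.

End rnorm.

(** * Monotonicity of the lower integral *)

Section lower_integral.
Context d (S : measurableType d) (R : realType).
Variable nu : {measure set S -> \bar R}.

(** The integral of a nonnegative function is a supremum over the simple
    functions below it, hence monotone without any measurability. *)
Lemma le_lower_integral (D : set S) (f g : S -> \bar R) :
  (forall x, D x -> 0 <= f x)%E -> (forall x, D x -> f x <= g x)%E ->
  (\int[nu]_(x in D) f x <= \int[nu]_(x in D) g x)%E.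
Proof.
move=> f0 fg; have g0 x : D x -> (0 <= g x)%E.
  by move=> Dx; exact: le_trans (f0 x Dx) (fg x Dx).
rewrite !ge0_integralE//; apply: ge_ereal_sup => _ [h /= hf <-].
apply: ereal_sup_ubound; exists h => //= x; apply: (le_trans (hf x)).
by rewrite !patchE; case: ifPn => // /set_mem; exact: fg.
Qed.

End lower_integral.

(** * Simple functions and their integral *)

Section simple_maps.
Variable R : realType.
Local Notation T := (lebesgueType R).
Local Notation mu := (leb R).

(** Maps with finitely many values, all of whose level sets are Lebesgue
    measurable.  Unlike [simple_function] this asks for no finiteness of the
    measure and no algebraic structure on the values, and is therefore stable
    under pairing and under composition with any map on the left. *)
Definition simple_map (Y : Type) (s : R -> Y) :=
  finite_set (range s) /\ forall y, measurable (s @^-1` [set y] : set T).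

Lemma simple_map_preimage (Y : Type) (s : R -> Y) (B : set Y) :
  simple_map s -> measurable (s @^-1` B : set T).
Proof.
move=> [fs ms].
rewrite [X in measurable X](_ : _ =
    \bigcup_(y in range s `&` B) s @^-1` [set y]).
  by apply: fin_bigcup_measurable => //; exact: finite_setIl.
apply/seteqP; split=> [x Bx|x [y [_ By] /= ->]//].
by exists (s x) => //; split => //; exists x.
Qed.

Lemma simple_map_measurable d (Y : measurableType d) (s : R -> Y) :
  simple_map s -> measurable_fun setT (s : T -> Y).
Proof. by move=> ss _ B mB; rewrite setTI; exact: simple_map_preimage. Qed.

Lemma simple_map_comp (Y Z : Type) (h : Y -> Z) (s : R -> Y) :
  simple_map s -> simple_map (h \o s).
Proof.
move=> ss; split; last first.
  by move=> z; rewrite comp_preimage; exact: simple_map_preimage.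
by have := finite_image h ss.1; rewrite image_comp.
Qed.

Lemma simple_map_pair (Y Z : Type) (s : R -> Y) (t : R -> Z) :
  simple_map s -> simple_map t -> simple_map (fun x => (s x, t x)).
Proof.
move=> [fs ms] [ft mt]; split.
  apply: sub_finite_set (finite_setX fs ft).
  by move=> _ [x _ <-]; split => /=; exists x.
move=> [y z]; rewrite [X in measurable X](_ : _ =
   (s @^-1` [set y]) `&` (t @^-1` [set z])); first exact: measurableI.
by apply/seteqP; split=> x /= => [[-> ->]|[-> ->]].
Qed.

Lemma simple_map_indic (A : set R) :
  measurable (A : set T) -> simple_map (fun x => x \in A).
Proof.
move=> mA; split.
  by apply: (@sub_finite_set _ _ [set true; false]) => // -[] _; [left|right].
case.
  rewrite [X in measurable X](_ : _ = A)//.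
  by apply/seteqP; split=> x /= xA; [exact: set_mem|exact: mem_set].
rewrite [X in measurable X](_ : _ = ~` A); first exact: measurableC.
apply/seteqP; split=> x /= xA; first by move=> Ax; rewrite (mem_set Ax) in xA.
by apply/negbTE/negP => /set_mem.
Qed.

End simple_maps.

Section simple_integral.
Variables (R : realType) (X : completeNormedModType R[i]).
Local Notation T := (lebesgueType R).
Local Notation mu := (leb R).
Implicit Types s t : R -> X.

(** The level set of 0 is the complement of the finitely many others, so it is
    measurable although [simple_function] does not mention it. *)
Lemma simple_functionP s : simple_function s <->
  simple_map s /\ (mu (s @^-1` [set~ 0%R]) < +oo)%E.
Proof.
split=> [[fs ms]|[ss moo]]; last first.
  split; first exact: ss.1.
  move=> c c0; split; first exact: ss.2.
  apply: le_lt_trans moo; apply: le_measure; rewrite ?inE.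
  - exact: ss.2.
  - exact: simple_map_preimage.
  - by move=> x /= ->; exact/eqP.
have supE : s @^-1` [set~ 0%R] =
    \bigcup_(c in range s `&` [set~ 0%R]) s @^-1` [set c].
  apply/seteqP; split=> [x /= sx0|x [c [_ c0] /= ->]//].
  by exists (s x) => //; split => //; exists x.
have mS c : c != 0 -> measurable (s @^-1` [set c] : set T) by move=> /ms[].
have fin : finite_set (range s `&` [set~ 0%R]) by exact: finite_setIl.
have mU : measurable (s @^-1` [set~ 0%R] : set T).
  by rewrite supE; apply: fin_bigcup_measurable => // c [_ /eqP]; exact: mS.
split.
  split=> // c; have [->|/mS//] := eqVneq c 0.
  rewrite [X in measurable X](_ : _ = ~` (s @^-1` [set~ 0%R])).
    exact: measurableC.
  by rewrite -preimage_setC setCK.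
rewrite supE measure_fin_bigcup//.
- rewrite fsbig_finite//= big_seq; apply: lte_sum_pinfty => c.
  by rewrite in_fset_set// inE => -[_ /eqP] /ms[].
- by move=> c d _ _ [x [/= <- <-]].
- by move=> c [_ /eqP]; exact: mS.
Qed.

Lemma simple_function_simple_map s : simple_function s -> simple_map s.
Proof. by move=> /simple_functionP[]. Qed.

(** The value of the simple integral may be computed from any finite
    measurable partition on which the function is constant, here the level sets
    of [j].  Taking for [j] a pair of simple functions reduces additivity to
    that of finite sums. *)
Lemma simple_integral_comp (Y : choiceType) (j : R -> Y) (h : Y -> X) :
  simple_map j -> (mu ((h \o j) @^-1` [set~ 0%R]) < +oo)%E ->
  simple_integral (h \o j) =
  \sum_(y \in range j) (fine (mu (j @^-1` [set y])))%:C *: h y.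
Proof.
move=> sj moo; have fj := sj.1.
rewrite /simple_integral (_ : range (h \o j) = h @` range j) ?image_comp//.
rewrite -image_comp !fsbig_finite//=; last exact: finite_image.
rewrite fset_set_image// [in RHS](partition_big_imfset _ h)/=.
apply: eq_bigr => c _.
have -> : \sum_(i <- fset_set (range j) | h i == c)
            (fine (mu (j @^-1` [set i])))%:C *: h i =
          (\sum_(i <- fset_set (range j) | h i == c)
            fine (mu (j @^-1` [set i])))%:C *: c.
  rewrite rmorph_sum/= scaler_suml; apply: eq_bigr => i /eqP <- //.
have [->|c0] := eqVneq c 0; first by rewrite !scaler0.
congr (_%:C *: _).
rewrite sum_fine; last first.
  move=> i /eqP hic; rewrite ge0_fin_numE//; apply: le_lt_trans moo.
  apply: le_measure; rewrite ?inE; 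
    [exact: sj.2|by rewrite comp_preimage; exact: simple_map_preimage|].
  by move=> x /= ->; rewrite hic; exact/eqP.
congr fine; rewrite big_fset_condE/= -measure_fbigsetU/=.
- congr (mu _); rewrite -bigcup_fset; apply/seteqP; split=> [x /= hjx|x].
    exists (j x) => //=; rewrite !inE/= in_fset_set// hjx eqxx andbT.
    by apply/mem_set; exists x.
  by move=> [y /=]; rewrite !inE => /andP[_ /eqP <-] /= ->.
- by move=> i _; exact: sj.2.
- by move=> i k _ _ [x [/= <- <-]].
Qed.

Lemma simple_integralB s t : simple_function s -> simple_function t ->
  simple_function (fun x => s x - t x) /\
  simple_integral (fun x => s x - t x) = simple_integral s - simple_integral t.
Proof.
move=> /simple_functionP[ss soo] /simple_functionP[st too].
have sp := simple_map_pair ss st.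
have uoo : (mu ([set x | s x != 0%R] `|` [set x | t x != 0%R]) < +oo)%E.
  apply: (@le_lt_trans _ _ (mu (s @^-1` [set~ 0%R]) + mu (t @^-1` [set~ 0%R]))%E).
    apply: (le_trans _ (outer_measureU2 _ _ _)).
    by apply: le_outer_measure; move=> x [|] /= /eqP; [left|right].
  exact: lte_add_pinfty.
have boo : (mu ((fun x => (s x - t x)%R) @^-1` [set~ 0%R]) < +oo)%E.
  apply: le_lt_trans uoo; apply: le_outer_measure => x /= st0.
  have [s0|] := eqVneq (s x) 0; last by left.
  by right; apply/eqP => t0; apply: st0; rewrite s0 t0 subr0.
split.
  apply/simple_functionP; split=> //.
  exact: (simple_map_comp (fun y => y.1 - y.2) sp).
rewrite (@simple_integral_comp _ _ (fun y => y.1 - y.2) sp boo).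
rewrite (@simple_integral_comp _ _ fst sp soo).
rewrite (@simple_integral_comp _ _ snd sp too).
have fp := sp.1.
rewrite !fsbig_finite//= -sumrB; apply: eq_bigr => y _.
by rewrite scalerBr.
Qed.

Lemma simple_function_rnorm s : simple_function s ->
  measurable_fun setT ((fun x => (rnorm (s x))%:E) : T -> \bar R).
Proof.
move=> ss; apply: simple_map_measurable.
exact: (simple_map_comp (fun y => (rnorm y)%:E) (simple_function_simple_map ss)).
Qed.

Lemma rnorm_simple_integral s : simple_function s ->
  ((rnorm (simple_integral s))%:E <= \int[mu]_x (rnorm (s x))%:E)%E.
Proof.
move=> /[dup] /simple_function_simple_map ss [fs ms].
have ffs := ss.1.
have -> : (\int[mu]_x (rnorm (s x))%:E =
    \sum_(c \in range s) (rnorm c)%:E * mu (s @^-1` [set c]))%E.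
  transitivity (\int[mu]_x \sum_(c \in range s)
      ((rnorm c)%:E * (\1_(s @^-1` [set c]) x)%:E))%E.
    apply: eq_integral => x _; rewrite (fsbigD1 (s x))//=; last by exists x.
    rewrite indicE mem_set// mule1 fsbig1 ?adde0// => c [_ /= csx].
    by rewrite indicE memNset ?mule0//= => scx; apply: csx.
  have mi c : measurable_fun setT
      ((fun x => (\1_(s @^-1` [set c]) x)%:E) : T -> \bar R).
    by apply/measurable_EFinP; apply: measurable_indic; exact: ss.2.
  have i0 c x : setT x -> (0 <= (\1_(s @^-1` [set c]) x)%:E :> \bar R)%E.
    by rewrite lee_fin indicE.
  have mci c : measurable_fun setT
      ((fun x => (rnorm c)%:E * (\1_(s @^-1` [set c]) x)%:E)%E : T -> \bar R).
    by apply: measurable_funeM; exact: mi.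
  have ci0 c x : setT x ->
      (0 <= (rnorm c)%:E * (\1_(s @^-1` [set c]) x)%:E)%E.
    by move=> Tx; rewrite mule_ge0 ?i0// lee_fin rnorm_ge0.
  rewrite (ge0_integral_fsum mu measurableT mci ci0 ffs).
  apply: eq_fsbigr => c _.
  rewrite (ge0_integralZl_EFin mu measurableT (i0 c) (mi c) (rnorm_ge0 c)).
  by rewrite (integral_indic mu measurableT (ss.2 c)) setIT.
rewrite /simple_integral !fsbig_finite//=.
apply: (@le_trans _ _ (\sum_(c <- fset_set (range s))
    rnorm ((fine (mu (s @^-1` [set c])))%:C *: c))%:E).
  rewrite lee_fin; elim/big_rec2 : _ => [|c u v _ uv]; first by rewrite rnorm0.
  by rewrite (le_trans (rnormD _ _))// lerD2l.
rewrite -sumEFin; apply: lee_sum => c _.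
rewrite rnormZ rnorm_real ger0_norm ?fine_ge0//.
have [->|/ms[mc coo]] := eqVneq c 0; first by rewrite rnorm0 mulr0 mul0e.
by rewrite EFinM fineK 1?muleC// ge0_fin_numE.
Qed.

End simple_integral.

(** * The Bochner integral *)

Section bochner_theory.
Variables (R : realType) (X : completeNormedModType R[i]).
Local Notation T := (lebesgueType R).
Local Notation mu := (leb R).
Implicit Types (f g : R -> X) (v w : X).

Lemma aeS (P Q : R -> Prop) : (forall x, P x -> Q x) ->
  {ae mu, forall x, P x} -> {ae mu, forall x, Q x}.
Proof. by move=> PQ; apply: (@filterS _ _ (ae_filter_ringOfSetsType _)). Qed.

Lemma aeS2 (P Q S : R -> Prop) : (forall x, P x -> Q x -> S x) ->
  {ae mu, forall x, P x} -> {ae mu, forall x, Q x} -> {ae mu, forall x, S x}.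
Proof.
move=> PQS aP aQ.
exact: (@filterS2 _ _ (ae_filter_ringOfSetsType mu) _ _ _ PQS aP aQ).
Qed.

(** An almost everywhere limit agrees almost everywhere with the limsup, which
    is enough because Lebesgue measure is complete. *)
Lemma ae_cvg_measurable (u_ : nat -> R -> \bar R) (u : R -> \bar R) :
  (forall n, measurable_fun setT (u_ n : T -> \bar R)) ->
  {ae mu, forall x, u_ n x @[n --> \oo] --> u x} ->
  measurable_fun setT (u : T -> \bar R).
Proof.
move=> mu_ uu.
have ml : measurable_fun setT ((fun x => limn_esup (u_ ^~ x)) : T -> \bar R).
  exact: measurable_fun_limn_esup.
apply: (ae_measurable_fun completed_lebesgue_measure_is_complete _ ml).
apply: aeS uu => x ux _ /=.
by have [_ ->] := cvg_limn_einf_sup ux.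
Qed.

Lemma simple_approx_cst (s : R -> X) :
  simple_function s -> simple_approx s (fun=> s).
Proof. by move=> ss; split=> //; apply: aeW => x; exact: cvg_cst. Qed.

Lemma simple_approxB f g (s t : nat -> R -> X) :
  simple_approx f s -> simple_approx g t ->
  simple_approx (fun x => f x - g x) (fun n x => s n x - t n x).
Proof.
move=> [ss fs] [st gt]; split.
  by move=> n; exact: (simple_integralB (ss n) (st n)).1.
by apply: aeS2 fs gt => x; exact: cvgB.
Qed.

Lemma simple_approx_measurable f s : simple_approx f s ->
  measurable_fun setT ((fun x => (rnorm (f x))%:E) : T -> \bar R).
Proof.
move=> [ss fs]; apply: (@ae_cvg_measurable (fun n x => (rnorm (s n x))%:E)).
  by move=> n; exact: simple_function_rnorm.
by apply: aeS fs => x sx; apply: cvg_EFin; [exact: nearW|exact: cvg_rnorm].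
Qed.

Lemma strongly_measurable_rnorm f : strongly_measurable f ->
  measurable_fun setT ((fun x => (rnorm (f x))%:E) : T -> \bar R).
Proof. by move=> [s]; exact: simple_approx_measurable. Qed.

Lemma simple_approx_measurableB f s n : simple_approx f s ->
  measurable_fun setT ((fun x => (rnorm (f x - s n x))%:E) : T -> \bar R).
Proof.
move=> fs; have /simple_approx_cst sn := fs.1 n.
exact: simple_approx_measurable (simple_approxB fs sn).
Qed.

Lemma integral_rnormB f g :
  measurable_fun setT ((fun x => (rnorm (f x))%:E) : T -> \bar R) ->
  measurable_fun setT ((fun x => (rnorm (g x))%:E) : T -> \bar R) ->
  (\int[mu]_x (rnorm (f x - g x))%:E <=
   \int[mu]_x (rnorm (f x))%:E + \int[mu]_x (rnorm (g x))%:E)%E.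
Proof.
move=> mf mg.
have f0 (h : R -> X) x : setT x -> (0 <= (rnorm (h x))%:E)%E.
  by rewrite lee_fin rnorm_ge0.
rewrite -(ge0_integralD mu measurableT (f0 f) mf (f0 g) mg).
apply: le_lower_integral => x _; first by rewrite lee_fin rnorm_ge0.
by rewrite -EFinD lee_fin rnormB.
Qed.

Lemma is_bochner_integralB f g v w :
  is_bochner_integral f v -> is_bochner_integral g w ->
  is_bochner_integral (fun x => f x - g x) (v - w).
Proof.
move=> [s [fs fs0 sv]] [t [gt gt0 tw]].
exists (fun n x => s n x - t n x); split.
- exact: simple_approxB.
- have E n x : f x - g x - (s n x - t n x) = (f x - s n x) - (g x - t n x).
    by rewrite opprD addrACA -opprD.
  apply: (@squeeze_cvge _ _ _ _ (cst 0%E) _ (fun n =>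
    \int[mu]_x (rnorm (f x - s n x))%:E +
    \int[mu]_x (rnorm (g x - t n x))%:E)%E).
  + apply: nearW => n; apply/andP; split.
      by apply: integral_ge0 => x _; rewrite lee_fin rnorm_ge0.
    under eq_integral do rewrite E.
    apply: (@integral_rnormB (fun x => f x - s n x) (fun x => g x - t n x)).
    * exact: simple_approx_measurableB.
    * exact: simple_approx_measurableB.
  + exact: cvg_cst.
  + by rewrite -[X in _ --> X]adde0; apply: cvgeD.
- rewrite (_ : (fun n => _) =
    (fun n => simple_integral (s n) - simple_integral (t n))).
    exact: cvgB.
  by apply/funext => n; exact: (simple_integralB (fs.1 n) (gt.1 n)).2.
Qed.

Lemma cvge0_near_lt (u : nat -> \bar R) (e : R) :
  u n @[n --> \oo] --> 0%E -> 0 < e -> \forall n \near \oo, (u n < e%:E)%E.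
Proof.
move=> /fine_cvgP[ufin /cvgrPdist_lt u0] e0.
apply: filterS2 ufin (u0 e e0) => n un; rewrite sub0r normrN => une.
by rewrite -(fineK un) lte_fin (le_lt_trans (ler_norm _)).
Qed.

(** Contraction from L1 to [X], inherited from simple functions by passing to
    the limit; uniqueness of the integral is the case of difference 0. *)
Lemma rnorm_is_bochner_integral f v : is_bochner_integral f v ->
  ((rnorm v)%:E <= \int[mu]_x (rnorm (f x))%:E)%E.
Proof.
move=> [s [fs fs0 sv]].
have mf := simple_approx_measurable fs.
apply/lee_addgt0Pr => e e0.
have e20 : 0 < e / 2 by rewrite divr_gt0.
have /cvg_rnormP/cvgrPdist_lt/(_ _ e20) := sv.
move=> /(filterI (cvge0_near_lt fs0 e20)) [N _ /(_ N (leqnn _))] [fsN].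
rewrite sub0r normrN ger0_norm ?rnorm_ge0// => vN.
have vE : v = (v - simple_integral (s N)) + simple_integral (s N).
  by rewrite subrK.
rewrite {1}vE (@le_trans _ _ ((e / 2)%:E +
    (rnorm (simple_integral (s N)))%:E)%E)//.
  by rewrite -EFinD lee_fin (le_trans (rnormD _ _))// lerD2r ltW.
rewrite [e in leRHS](splitr e) EFinD addeA [leLHS]addeC leeD2r//.
apply: (le_trans (rnorm_simple_integral (fs.1 N))).
apply: (@le_trans _ _ (\int[mu]_x (rnorm (f x))%:E +
    \int[mu]_x (rnorm (f x - s N x))%:E)%E); last by rewrite leeD2l// ltW.
have sE x : s N x = f x - (f x - s N x) by rewrite subKr.
under eq_integral do rewrite sE.
apply: (@integral_rnormB f (fun x => f x - s N x) mf).
exact: simple_approx_measurableB.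
Qed.

Lemma is_bochner_integral_unique f v w :
  is_bochner_integral f v -> is_bochner_integral f w -> v = w.
Proof.
move=> fv fw; apply/eqP; rewrite -subr_eq0; apply/eqP; apply: rnorm0_eq0.
have := rnorm_is_bochner_integral (is_bochner_integralB fv fw).
under eq_integral do rewrite subrr rnorm0.
rewrite integral0 lee_fin => vw.
by apply/eqP; rewrite eq_le vw rnorm_ge0.
Qed.

Lemma bochner_integralE f v : is_bochner_integral f v -> bochner_integral f = v.
Proof.
move=> fv; rewrite /bochner_integral; case: xgetP => [w _ fw|/(_ v)]//.
exact: is_bochner_integral_unique fw fv.
Qed.

(** Cutting the approximating functions off where they exceed twice the
    integrand makes convergence almost everywhere dominated. *)
Lemma simple_approx_L1 f : strongly_measurable f ->
  (\int[mu]_x (rnorm (f x))%:E < +oo)%E ->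
  exists s, simple_approx f s /\
    (\int[mu]_x (rnorm (f x - s n x))%:E)%E @[n --> \oo] --> 0%E.
Proof.
move=> [s fs] foo.
pose A n : set R := [set x | rnorm (s n x) <= 2 * rnorm (f x)].
pose t n x := if x \in A n then s n x else 0.
have mf := simple_approx_measurable fs.
have mA n : measurable (A n : set T).
  have -> : A n = (fun x => (rnorm (s n x))%:E <= 2%:E * (rnorm (f x))%:E)%E @^-1` [set true].
    by apply/seteqP; split=> x /=; rewrite /A/= -EFinM lee_fin.
  rewrite -[X in measurable X]setTI.
  apply: (measurable_fun_lee (simple_function_rnorm (fs.1 n)) (measurable_funeM _ mf)) => //.
have at_ : simple_approx f t.
  split=> [n|].
    have /simple_functionP[ss soo] := fs.1 n.
    apply/simple_functionP; split.
      exact: (simple_map_comp (fun y => if y.2 then y.1 else 0)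
        (simple_map_pair ss (simple_map_indic (mA n)))).
    apply: le_lt_trans soo; apply: le_outer_measure => x /=.
    by rewrite /t; case: ifPn.
  have [_] := fs; apply: aeS => x sx.
  apply/cvgrPdist_lt => e e0.
  have [fx0|fx0] := eqVneq (f x) 0.
    near=> n; rewrite /t; case: ifPn => [|_]; last by rewrite fx0 subr0 normr0.
    rewrite inE /A/= fx0 rnorm0 mulr0 => sn0.
    rewrite (_ : s n x = 0) ?subr0 ?normr0//; apply: rnorm0_eq0.
    by apply/eqP; rewrite eq_le sn0 rnorm_ge0.
  have rf0 : 0 < rnorm (f x).
    rewrite lt_neqAle rnorm_ge0 andbT eq_sym; apply: contra_neq fx0.
    exact: rnorm0_eq0.
  have := cvg_rnorm sx => /cvgrPdist_lt/(_ _ rf0) sf.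
  move/cvgrPdist_lt : sx => /(_ e e0); apply: filterS2 sf => n sf sx.
  rewrite /t mem_set//= /A/=; move: sf; rewrite ltr_norml => /andP[+ _].
  by rewrite ltrBrDl ltrBlDr mulr_natl mulr2n => /ltW.
exists t; split=> //.
have if3 : mu.-integrable setT (fun x => 3%:E * (rnorm (f x))%:E)%E.
  apply: integrableZl => //; apply/integrableP; split => //.
  by under eq_integral do rewrite gee0_abs ?lee_fin ?rnorm_ge0//.
have := @dominated_convergence _ T R mu setT measurableT
  (fun n x => (rnorm (f x - t n x))%:E) (cst 0%E) _
  (fun n => simple_approx_measurableB n at_) _ _ if3.
case.
- exact: measurable_cst.
- have [_] := at_; apply: aeS => x tx _; apply: cvg_EFin; first exact: nearW.
  exact/cvg_rnormP.
- apply: aeW => x n _; rewrite gee0_abs ?lee_fin ?rnorm_ge0//.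
  rewrite (le_trans (rnormB _ _))// -[3]/(1 + 2)%:R natrD mulrDl mul1r lerD2l.
  rewrite /t; case: ifPn => [|_]; first by rewrite inE.
  by rewrite rnorm0 mulr_ge0// rnorm_ge0.
- by move=> _ _; rewrite integral0.
Unshelve. all: by end_near. Qed.

(** Along an L1 approximation the simple integrals form a Cauchy sequence. *)
Lemma is_bochner_integral_exists f : strongly_measurable f ->
  (\int[mu]_x (rnorm (f x))%:E < +oo)%E -> exists v, is_bochner_integral f v.
Proof.
move=> mf foo; have [s [fs fs0]] := simple_approx_L1 mf foo.
suff : cvg (simple_integral (s n) @[n --> \oo]).
  by move=> /cvg_ex[v sv]; exists v, s.
apply: cauchy_cvg; apply: cauchy_exP => e e0.
have eE : e = (complex.Re e)%:C by rewrite RRe_real// gtr0_real.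
have e20 : 0 < complex.Re e / 2.
  by move: e0; rewrite ltcE => /andP[_ e0]; rewrite divr_gt0.
have [N _ sN] := cvge0_near_lt fs0 e20.
exists (simple_integral (s N)); exists N => // n /= Nn.
rewrite -ball_normE/= norm_rnorm eE ltcR -lte_fin.
have [sb <-] := simple_integralB (fs.1 N) (fs.1 n).
apply: (le_lt_trans (rnorm_simple_integral sb)).
apply: (@le_lt_trans _ _ (\int[mu]_x (rnorm (f x - s n x))%:E +
    \int[mu]_x (rnorm (f x - s N x))%:E)%E); last first.
  by rewrite [X in (_ < X%:E)%E]splitr EFinD; apply: lteD; apply: sN => /=.
have sE x : s N x - s n x = (f x - s n x) - (f x - s N x).
  by rewrite opprB [RHS]addrC subrKA.
under eq_integral do rewrite sE.
apply: (@integral_rnormB (fun x => f x - s n x) (fun x => f x - s N x)).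
- exact: simple_approx_measurableB.
- exact: simple_approx_measurableB.
Qed.

End bochner_theory.

(** * Invariance under reflections and translations *)

Section reflection.
Variable R : realType.
Local Notation T := (lebesgueType R).
Local Notation mu := (leb R).

(** A translation is a product of two reflections, so that invariance has to be
    established for reflections only. *)
Definition refl (c y : R) : R := c - y.

Lemma reflK c : involutive (refl c).
Proof. by move=> y; rewrite /refl subKr. Qed.

(** A Borel measure agreeing with the length on half-open intervals is Lebesgue
    measure; a reflection exchanges the two kinds of half-open intervals. *)
Lemma lebesgue_measure_refl c (A : set (measurableTypeR R)) :
  measurable A -> lebesgue_measure (refl c @^-1` A) = lebesgue_measure A.
Proof.
have mr : measurable_fun setT (refl c : measurableTypeR R -> measurableTypeR R).
  by apply: measurable_funB => //; exact: measurable_cst.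
rewrite -[LHS]/(pushforward lebesgue_measure
  (refl c : measurableTypeR R -> measurableTypeR R) A) => mA.
apply/esym/lebesgue_measure_unique => //= _ [[a b] _ <-]; rewrite /pushforward.
rewrite (_ : refl c @^-1` _ = `[c - b, c - a[%classic).
  rewrite !lebesgue_measure_itv/= !lte_fin ltrD2l ltrN2.
  by case: ifP => // _; rewrite -!EFinB; congr EFin; ring.
apply/seteqP; split=> x /=; rewrite !in_itv/= /refl => /andP[ax xb];
  apply/andP; split; lra.
Qed.

(** A Lebesgue measurable set is the union of a Borel set and a subset of a Borel
    null set, and the Borel case applies to both. *)
Lemma measurable_refl_preimage c (A : set R) : measurable (A : set T) ->
  measurable (refl c @^-1` A : set T) /\ mu (refl c @^-1` A) = mu A.
Proof.
have mr : measurable_fun setT (refl c : measurableTypeR R -> measurableTypeR R).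
  by apply: measurable_funB => //; exact: measurable_cst.
have rm B : measurable (B : set (measurableTypeR R)) ->
    measurable (refl c @^-1` B : set (measurableTypeR R)).
  by move=> mB; rewrite -[X in measurable X]setTI; exact: mr.
move=> mA.
have : (completed_algebra_gen (@lebesgue_measure R)) A.
  by rewrite -g_sigma_completed_algebra_genE completed_caratheodory_measurable.
move=> [B mB [N [C [mC C0 NC]] BN]].
have mB' : measurable (B : set T) by exact: sub_caratheodory.
have mC' : measurable (C : set T) by exact: sub_caratheodory.
have muA : mu A = mu B.
  rewrite -BN; apply/eqP; rewrite eq_le; apply/andP; split; last first.
    by apply: le_outer_measure => x; left.
  rewrite (le_trans (outer_measureU2 _ _ _))// -[leRHS]adde0 leeD2l//.
  by rewrite -C0; exact: le_outer_measure.
have rN0 : mu (refl c @^-1` N) = 0%E.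
  apply/eqP; rewrite eq_le; apply/andP; split.
    rewrite -C0 -(lebesgue_measure_refl c mC).
    by apply: le_outer_measure => x /NC.
  exact: outer_measure_ge0.
have mN : measurable (refl c @^-1` N : set T).
  apply: negligible_sub_caratheodory.
  exists (refl c @^-1` C); split.
  - by apply: sub_caratheodory; exact: rm.
  - by rewrite -C0; exact: lebesgue_measure_refl.
  - by move=> x /NC.
rewrite -BN preimage_setU; split.
  by apply: measurableU => //; apply: sub_caratheodory; exact: rm.
rewrite BN muA -[RHS](lebesgue_measure_refl c mB).
apply/eqP; rewrite eq_le; apply/andP; split; last first.
  by apply: le_outer_measure => x; left.
rewrite (le_trans (outer_measureU2 _ _ _))// -[leRHS]adde0 leeD2l//.
by rewrite -rN0.
Qed.

Lemma measurable_refl c : measurable_fun setT (refl c : T -> T).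
Proof.
by move=> _ A mA; rewrite setTI; exact: (measurable_refl_preimage c mA).1.
Qed.

Lemma measurable_fun_refl d (Y : measurableType d) c (f : T -> Y) :
  measurable_fun setT f -> measurable_fun setT (f \o refl c : T -> Y).
Proof. by move=> mf; exact: measurableT_comp (measurable_refl c). Qed.

Lemma ge0_integral_refl c (f : R -> \bar R) :
  measurable_fun setT (f : T -> \bar R) -> (forall x, 0 <= f x)%E ->
  (\int[mu]_x f (c - x)%R = \int[mu]_x f x)%E.
Proof.
move=> mf f0.
rewrite -[LHS]/(\int[mu]_(x in (refl c : T -> T) @^-1` setT)
  (f \o (refl c : T -> T)) x)%E.
rewrite -(@ge0_integral_pushforward _ _ _ _ _ _ (measurable_refl c))//.
apply: eq_measure_integral; first exact: measurable_refl.
move=> _ A mA _ /=.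
by rewrite /pushforward (measurable_refl_preimage c mA).2.
Qed.

Lemma ae_refl c (P : R -> Prop) :
  {ae mu, forall x, P x} -> {ae mu, forall x, P (c - x)}.
Proof.
move=> [N [mN N0 PN]]; exists (refl c @^-1` N); split.
- exact: (measurable_refl_preimage c mN).1.
- by rewrite (measurable_refl_preimage c mN).2.
- by move=> x; exact: PN.
Qed.

Lemma ge0_integral_shift c (f : R -> \bar R) :
  measurable_fun setT (f : T -> \bar R) -> (forall x, 0 <= f x)%E ->
  (\int[mu]_x f (x + c)%R = \int[mu]_x f x)%E.
Proof.
move=> mf f0; rewrite -[RHS](ge0_integral_refl c mf f0).
rewrite -[RHS](ge0_integral_refl 0 (measurable_fun_refl c mf)); last first.
  by move=> x; exact: f0.
by apply: eq_integral => x _; rewrite /= /refl sub0r opprK addrC.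
Qed.

End reflection.

Section reflection_bochner.
Variables (R : realType) (X : completeNormedModType R[i]).
Local Notation T := (lebesgueType R).
Local Notation mu := (leb R).
Implicit Types f : R -> X.

Lemma simple_map_refl c (Y : Type) (s : R -> Y) :
  simple_map s -> simple_map (s \o refl c).
Proof.
move=> [fs ms]; split; last first.
  by move=> y; rewrite comp_preimage; exact: (measurable_refl_preimage c (ms y)).1.
by apply: sub_finite_set fs => _ [x _ <-]; exists (refl c x).
Qed.

Lemma simple_approx_refl c f s : simple_approx f s ->
  simple_approx (f \o refl c) (fun n => s n \o refl c).
Proof.
move=> [ss sf]; split; last exact: ae_refl sf.
move=> n; have /simple_functionP[sn soo] := ss n.
apply/simple_functionP; split; first exact: simple_map_refl.
rewrite comp_preimage (measurable_refl_preimage c _).2//.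
exact: simple_map_preimage.
Qed.

Lemma strongly_measurable_refl c f :
  strongly_measurable f -> strongly_measurable (f \o refl c).
Proof.
by move=> [s fs]; exists (fun n => s n \o refl c); exact: simple_approx_refl.
Qed.

Lemma simple_integral_refl c (s : R -> X) : simple_map s ->
  simple_integral (s \o refl c) = simple_integral s.
Proof.
move=> ss; rewrite /simple_integral.
have -> : range (s \o refl c) = range s.
  apply/seteqP; split=> _ [x _ <-]; first by exists (refl c x).
  by exists (refl c x) => //=; rewrite reflK.
apply: eq_fsbigr => v _; rewrite comp_preimage.
by rewrite (measurable_refl_preimage c (ss.2 v)).2.
Qed.

Lemma is_bochner_integral_refl c f v :
  is_bochner_integral f v -> is_bochner_integral (f \o refl c) v.
Proof.
move=> [s [fs fs0 sv]]; exists (fun n => s n \o refl c); split.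
- exact: simple_approx_refl.
- under eq_fun.
    move=> n.
    rewrite (@ge0_integral_refl _ c (fun x => (rnorm (f x - s n x))%:E)); last 2 first.
    + exact: simple_approx_measurableB.
    + by move=> x; rewrite lee_fin rnorm_ge0.
  over.
  exact: fs0.
- under eq_fun.
    move=> n; rewrite simple_integral_refl; last first.
      exact/simple_function_simple_map/fs.1.
  over.
  exact: sv.
Qed.

Lemma is_bochner_integral_shift c f v :
  is_bochner_integral f v -> is_bochner_integral (fun y => f (y + c)) v.
Proof.
move=> /(is_bochner_integral_refl c)/(is_bochner_integral_refl 0).
congr is_bochner_integral; apply/funext => y.
by rewrite /= /refl sub0r opprK addrC.
Qed.

Lemma strongly_measurable_shift c f :
  strongly_measurable f -> strongly_measurable (fun y => f (y + c)).
Proof.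
move=> /(strongly_measurable_refl c)/(strongly_measurable_refl 0).
congr strongly_measurable; apply/funext => y.
by rewrite /= /refl sub0r opprK addrC.
Qed.

End reflection_bochner.

(** * Continuity of translation in L1 *)

Section translation_L1.
Variable R : realType.
Local Notation T := (lebesgueType R).
Local Notation mu := (leb R).
Implicit Types (u w : R -> R) (h : nat -> R).

(** Continuity of translation along [u] in L1, tested on sequences so that
    dominated convergence applies directly. *)
Definition L1_continuous u :=
  measurable_fun setT (u : T -> R) /\
  forall h, h @ \oo --> (0 : R) ->
    (\int[mu]_y `|u (y + h n) - u y|%:E)%E @[n --> \oo] --> 0%E.

Lemma measurable_fun_shift d (Y : measurableType d) c (f : R -> Y) :
  measurable_fun setT (f : T -> Y) ->
  measurable_fun setT ((fun y => f (y + c)) : T -> Y).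
Proof.
move=> /(measurable_fun_refl c)/(measurable_fun_refl 0).
by congr measurable_fun; apply/funext => y; rewrite /= /refl sub0r opprK addrC.
Qed.

Lemma measurable_dist (u w : R -> R) :
  measurable_fun setT (u : T -> R) -> measurable_fun setT (w : T -> R) ->
  measurable_fun setT ((fun y => `|u y - w y|%:E) : T -> \bar R).
Proof.
move=> ms mw; apply/measurable_EFinP.
exact: (measurableT_comp (@normr_measurable R setT) (measurable_funB ms mw)).
Qed.

Lemma near_le_cvge0 (v : nat -> \bar R) : (forall n, 0 <= v n)%E ->
  (forall e : R, 0 < e -> \forall n \near \oo, (v n <= e%:E)%E) ->
  v n @[n --> \oo] --> 0%E.
Proof.
move=> v0 ve; apply/fine_cvgP; split.
  apply: filterS (ve 1 ltr01) => n v1.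
  by rewrite ge0_fin_numE// (le_lt_trans v1)// ltry.
apply/cvgrPdist_le => e e0; apply: filterS (ve e e0) => n vn.
rewrite sub0r normrN ger0_norm ?fine_ge0//.
by rewrite -lee_fin fineK// ge0_fin_numE// (le_lt_trans vn)// ltry.
Qed.

(** An L1 limit of functions along which translation is continuous: the errors
    of [u] against [w] before and after the translation have the same size. *)
Lemma L1_continuous_closed u :
  measurable_fun setT (u : T -> R) ->
  (forall e : R, 0 < e -> exists2 w, L1_continuous w &
    (\int[mu]_y `|u y - w y|%:E <= e%:E)%E) ->
  L1_continuous u.
Proof.
move=> ms uw; split=> // h h0; apply: near_le_cvge0.
  by move=> n; apply: integral_ge0 => x _; rewrite lee_fin.
move=> e e0; have e3 : 0 < e / 3 by rewrite divr_gt0.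
have [w [mw wh] uwe] := uw _ e3.
apply: filterS (cvge0_near_lt (wh h h0) e3) => n whn.
have md := measurable_dist ms mw.
have mh := measurable_dist (measurable_fun_shift (h n) mw) mw.
have mdh := measurable_fun_shift (h n) md.
apply: (@le_trans _ _ (\int[mu]_y (`|u (y + h n) - w (y + h n)|%:E +
    (`|w (y + h n) - w y|%:E + `|u y - w y|%:E)))%E).
  apply: le_lower_integral => y _; first by rewrite lee_fin.
  rewrite -!EFinD lee_fin (distrC (u y) (w y)).
  apply: (le_trans (ler_distD (w (y + h n)) _ _)).
  by rewrite lerD2l ler_distD.
rewrite (ge0_integralD _ measurableT _ mdh _ (emeasurable_funD mh md)).
- rewrite (ge0_integralD _ measurableT _ mh _ md).
  + rewrite (@ge0_integral_shift _ (h n) _ md)//.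
    rewrite (_ : e = e / 3 + (e / 3 + e / 3)); last by field.
    by rewrite !EFinD; apply: leeD => //; apply: leeD => //; exact: ltW.
  + by move=> y _; rewrite lee_fin.
  + by move=> y _; rewrite lee_fin.
- by move=> y _; rewrite lee_fin.
- by move=> y _; rewrite -EFinD lee_fin addr_ge0.
Qed.

Lemma L1_continuous0 : L1_continuous (fun=> 0).
Proof.
split; first exact: measurable_cst.
move=> h _; have E n : (\int[mu]_y `|(fun=> 0) (y + h n) - (fun=> 0) y : R|%:E = 0)%E.
  by under eq_integral do rewrite subrr normr0; rewrite integral0.
by rewrite (funext E); exact: cvg_cst.
Qed.

Lemma L1_continuousD u w :
  L1_continuous u -> L1_continuous w -> L1_continuous (fun y => u y + w y).
Proof.
move=> [ms uh] [mw wh]; split; first exact: measurable_funD.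
move=> h h0; apply: (@squeeze_cvge _ _ _ _ (cst 0%E) _ (fun n =>
    \int[mu]_y `|u (y + h n) - u y|%:E + \int[mu]_y `|w (y + h n) - w y|%:E)%E).
- have mu_ n := measurable_dist (measurable_fun_shift (h n) ms) ms.
  have mw_ n := measurable_dist (measurable_fun_shift (h n) mw) mw.
  apply: nearW => n; apply/andP; split.
    by apply: integral_ge0 => y _; rewrite lee_fin.
  rewrite -(ge0_integralD _ measurableT _ (mu_ n) _ (mw_ n)).
  + apply: le_lower_integral => y _; first by rewrite lee_fin.
    by rewrite -EFinD lee_fin opprD addrACA ler_normD.
  + by move=> y _; rewrite lee_fin.
  + by move=> y _; rewrite lee_fin.
- exact: cvg_cst.
- by rewrite -[X in _ --> X]adde0; apply: cvgeD => //; [exact: uh|exact: wh].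
Qed.

Lemma L1_continuousZ c u :
  L1_continuous u -> L1_continuous (fun y => c * u y).
Proof.
move=> [ms uh]; split; first exact: measurable_funM.
move=> h h0.
have E n : (\int[mu]_y `|c * u (y + h n) - c * u y|%:E =
    `|c|%:E * \int[mu]_y `|u (y + h n) - u y|%:E)%E.
  have mh := measurable_dist (measurable_fun_shift (h n) ms) ms.
  have d0 (y : T) : setT y -> (0 <= `|u (y + h n) - u y|%:E)%E.
    by rewrite lee_fin.
  rewrite -(ge0_integralZl_EFin _ measurableT d0 mh)//.
  by apply: eq_integral => y _; rewrite -mulrBr normrM EFinM.
rewrite (funext E).
by rewrite -[X in _ --> X](mule0 `|c|%:E); apply: cvgeZl => //; exact: uh.
Qed.

(** For an open set [U] the indicator is lower semicontinuous, so the part of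
    [U] that a small translation moves out of [U] vanishes by dominated
    convergence; by invariance the part that it moves in has the same size as
    the part that the inverse translation moves out. *)
Lemma L1_continuous_open (U : set R) : open U -> (mu U < +oo)%E ->
  L1_continuous \1_U.
Proof.
move=> oU Uoo.
have mU : measurable (U : set T) by apply: sub_caratheodory; exact: open_measurable.
have m1 : measurable_fun setT (\1_U : T -> R) by exact: measurable_indic.
split=> // h h0.
pose D c y : R := \1_U y * (1 - \1_U (y + c)).
have mD c : measurable_fun setT ((fun y => (D c y)%:E) : T -> \bar R).
  apply/measurable_EFinP; apply: (measurable_funM m1).
  apply: measurable_funB; first exact: measurable_cst.
  exact: (measurable_fun_shift c m1).
have i01 y : (\1_U y : R) = 0 \/ (\1_U y : R) = 1.
  by rewrite indicE; case: (_ \in _); [right|left].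
have D0 c y : 0 <= D c y.
  by rewrite /D; case: (i01 y) => ->; case: (i01 (y + c)) => ->; lra.
have D1 c y : D c y <= \1_U y.
  by rewrite /D; case: (i01 y) => ->; case: (i01 (y + c)) => ->; lra.
have out k : k @ \oo --> (0 : R) ->
    (\int[mu]_y (D (k n) y)%:E)%E @[n --> \oo] --> 0%E.
  move=> k0.
  have iU : mu.-integrable setT (EFin \o \1_U).
    apply/integrableP; split; first exact/measurable_EFinP.
    rewrite (eq_integral (fun x : T => (\1_U x)%:E)).
      by rewrite integral_indic// setIT.
    by move=> x _; rewrite gee0_abs// lee_fin.
  have [] := @dominated_convergence _ T R mu setT measurableT
    (fun n y => (D (k n) y)%:E) (cst 0%E) _ (fun n => mD (k n))
    (measurable_cst _) _ iU.
  - apply: aeW => y _; apply: cvg_EFin; first exact: nearW.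
    have [Uy|Uy] := pselect (U y); last first.
      by rewrite /D indicE memNset//=; under eq_fun do rewrite mul0r; exact: cvg_cst.
    apply/cvgrPdist_lt => e e0.
    have yk : y + k n @[n --> \oo] --> y.
      by rewrite -[X in _ --> X]addr0; apply: cvgD => //; exact: cvg_cst.
    have : \forall n \near \oo, U (y + k n) by apply: yk; exact: open_nbhs_nbhs.
    apply: filterS => n /= Ukn.
    by rewrite /D !indicE mem_set// mem_set// subrr mulr0 subrr normr0.
  - apply: aeW => y n _; rewrite gee0_abs ?lee_fin//; exact: D1.
  - by move=> _ _; rewrite integral0.
have hN : (- h n) @[n --> \oo] --> (0 : R) by rewrite -oppr0; exact: cvgN.
have E n : (\int[mu]_y `|\1_U (y + h n) - \1_U y|%:E =
    \int[mu]_y (D (h n) y)%:E + \int[mu]_y (D (- h n)%R y)%:E)%E.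
  have D0E c (y : R) : (0 <= (D c y)%:E)%E by rewrite lee_fin.
  rewrite -(ge0_integral_shift (h n) (mD (- h n)) (D0E (- h n))).
  have := ge0_integralD mu measurableT (fun y _ => D0E (h n) y) (mD (h n))
    (fun y _ => D0E (- h n) (y + h n)) (measurable_fun_shift (h n) (mD (- h n))).
  move=> <-.
  apply: eq_integral => y _; rewrite -EFinD; congr EFin.
  rewrite /D addrK; case: (i01 y) => ->; case: (i01 (y + h n)) => ->;
    rewrite ?subrr ?subr0 ?sub0r ?normrN ?normr0 ?normr1; lra.
rewrite (funext E).
by rewrite -[X in _ --> X]adde0; apply: cvgeD => //; exact: out.
Qed.

(** By outer regularity, [E] differs from an open set by a small set. *)
Lemma L1_continuous_indic (E : set R) : measurable (E : set T) ->
  (mu E < +oo)%E -> L1_continuous \1_E.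
Proof.
move=> mE Eoo; apply: L1_continuous_closed.
  exact: (@measurable_indic _ T).
move=> e e0; have [U [oU EU Ue]] := outer_measure_open_le E e0.
have mU : measurable (U : set T) by apply: sub_caratheodory; exact: open_measurable.
have Uoo : (mu U < +oo)%E.
  by apply: (le_lt_trans Ue); rewrite lte_add_pinfty// ltry.
exists (\1_U); first exact: L1_continuous_open.
under eq_integral => y _.
  rewrite (_ : `|_|%:E = (\1_(U `\` E) y)%:E); last first.
    congr EFin; rewrite !indicE in_setD; case: (boolP (y \in E)) => /= yE.
      by rewrite (mem_set (EU y (set_mem yE)))/= subrr normr0.
    by rewrite sub0r normrN andbT normr_nat.
  over.
rewrite integral_indic ?setIT//; last exact: measurableD.
rewrite measureD// (setIidr EU) leeBlDr; last by rewrite ge0_fin_numE.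
by rewrite addeC.
Qed.


Import HBSimple.

Lemma sfun_simple_map (s : {sfun T >-> R}) : simple_map s.
Proof.
split; first exact: (fimfunP s).
by move=> y; exact: (measurable_funPTI s (measurable_set1 y)).
Qed.

(** Simple functions are dense in L1, and the level sets of an integrable simple
    function have finite measure except at the value 0. *)
Lemma integrable_L1_continuous u :
  mu.-integrable setT (EFin \o u) -> L1_continuous u.
Proof.
move=> iu; have mu_ : measurable_fun setT (u : T -> R).
  by apply/measurable_EFinP; exact: measurable_int iu.
apply: L1_continuous_closed => // e e0.
have [g [ig _ gu]] := approximation_sfun_integrable measurableT iu.
have [N _ /(_ N (leqnn N))/ltW ge] := cvge0_near_lt gu e0.
exists (g N : T -> R) => //.
move: {gu ge} (g N) (ig N) => s is_.
have ss := sfun_simple_map s.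
have -> : s = (fun y => \sum_(c <- fset_set (range s)) c * \1_(s @^-1` [set c]) y) :> (R -> R).
  apply/funext => y; rewrite -fsbig_finite//=.
  rewrite (fsbigD1 (s y))//=; last by exists y.
  rewrite indicE mem_set// mulr1 fsbig1 ?addr0// => c [_ /= cy].
  by rewrite indicE memNset ?mulr0//= => scy; apply: cy.
elim: (fset_set _ : seq R) => [|c r IH].
  by under eq_fun do rewrite big_nil; exact: L1_continuous0.
under eq_fun do rewrite big_cons.
apply: L1_continuousD; last exact: IH.
have [->|c0] := eqVneq c 0.
  by under eq_fun do rewrite mul0r; exact: L1_continuous0.
apply: L1_continuousZ; apply: L1_continuous_indic; first exact: ss.2.
have le_cs : (`|c|%:E * mu (s @^-1` [set c]) <= \int[mu]_y `|(s y)%:E|)%E.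
  have mabs : measurable_fun setT ((fun y => `|(s y)%:E|%E) : T -> \bar R).
    have /integrableP[ms _] := is_.
    exact: (measurableT_comp (@abse_measurable R setT) ms).
  apply: (@le_trans _ _ (\int[mu]_(y in s @^-1` [set c]) `|(s y)%:E|)%E).
    rewrite -(integral_cst mu (ss.2 c)).
    by apply: le_lower_integral => y /= sc; rewrite ?sc lee_fin.
  exact: (ge0_subset_integral _ (ss.2 c) measurableT mabs).
rewrite ltey; apply/eqP => cy; move: le_cs; rewrite cy gt0_muley; last first.
  by rewrite lte_fin normr_gt0.
rewrite leye_eq => /eqP sy.
by have /integrableP[_] := is_; rewrite [X in (X < _)%E]sy.
Qed.

Lemma L1_continuous_refl u (xs : nat -> R) (x : R) :
  L1_continuous u -> xs @ \oo --> x ->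
  (\int[mu]_y `|u (xs n - y) - u (x - y)|%:E)%E @[n --> \oo] --> 0%E.
Proof.
move=> [ms uh] xsx.
have hx0 : (xs n - x) @[n --> \oo] --> (0 : R).
  by rewrite -(subrr x); apply: cvgB => //; exact: cvg_cst.
have E n : (\int[mu]_y `|u (xs n - y) - u (x - y)|%:E =
   \int[mu]_y `|u (y + (xs n - x)) - u y|%:E)%E.
  have mh := measurable_dist (measurable_fun_shift (xs n - x) ms) ms.
  rewrite -(ge0_integral_refl x mh); last by move=> y; rewrite lee_fin.
  by apply: eq_integral => y _; rewrite [x - y + _]addrC addrA subrK.
by rewrite (funext E); exact: uh hx0.
Qed.

End translation_L1.


(** * Strong measurability and convolution *)

Section approximation_by_simple_maps.
Import HBSimple.
Variables (R : realType) (X : completeNormedModType R[i]).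
Local Notation T := (lebesgueType R).
Local Notation mu := (leb R).

Lemma measurable_fun_real_simple (u : R -> R) :
  measurable_fun setT (u : T -> R) ->
  exists s : nat -> R -> R, (forall n, simple_map (s n)) /\
    forall x, s n x @[n --> \oo] --> u x.
Proof.
move=> /measurable_EFinP mu_.
have [g gu] := approximation_sfun measurableT mu_.
exists (fun n => g n : T -> R); split; first by move=> n; exact: sfun_simple_map.
by move=> x; have /fine_cvgP[] := gu x Logic.I.
Qed.

Lemma rnormc_le (z : R[i]) :
  rnorm (z : R[i]^o) <= `|complex.Re z| + `|complex.Im z|.
Proof.
rewrite /rnorm normc_def/= -[leRHS]ger0_norm ?addr_ge0// -sqrtr_sqr.
apply: ler_wsqrtr; rewrite sqrrD !real_normK ?num_real//.
by rewrite addrAC lerDl mulrn_wge0// mulr_ge0.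
Qed.

Lemma lebesgue_set_of_borel (A : set R) :
  measurable A -> measurable (A : set T).
Proof. by move=> mA; exact: sub_caratheodory. Qed.

Lemma measurable_fun_of_borel d (Y : measurableType d) (u : R -> Y) :
  measurable_fun setT u -> measurable_fun setT (u : T -> Y).
Proof.
move=> mu_ _ B mB; rewrite setTI; apply: lebesgue_set_of_borel.
by rewrite -[X in measurable X]setTI; exact: mu_.
Qed.

(** Sampling [g] along simple approximations of the identity, inside the bounded
    intervals [-n, n] to keep the supports of finite measure. *)
Lemma seq_continuous_strongly_measurable (g : R -> X) :
  (forall (xs : nat -> R) (x : R), xs @ \oo --> x ->
    g (xs n) @[n --> \oo] --> g x) ->
  strongly_measurable g.
Proof.
move=> gc.
have [h [hs hx]] := measurable_fun_real_simple
  (measurable_fun_of_borel (@measurable_id _ R setT)).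
pose A n : set R := `[- n%:R, n%:R]%classic.
have mA n : measurable (A n : set T).
  by apply: lebesgue_set_of_borel; exact: measurable_itv.
exists (fun n x => if x \in A n then g (h n x) else 0); split.
  move=> n; apply/simple_functionP; split.
    exact: (simple_map_comp (fun y => if y.2 then g y.1 else 0)
        (simple_map_pair (hs n) (simple_map_indic (mA n)))).
  apply: (@le_lt_trans _ _ (mu (A n))).
    apply: le_outer_measure => x /=; case: ifPn => // xA _.
    exact: set_mem.
  have -> : mu (A n) = lebesgue_measure (A n) by [].
  rewrite lebesgue_measure_itv/= lte_fin; case: ifP => _; last exact: ltry.
  by rewrite -EFinB ltry.
apply: aeW => x; apply/cvgrPdist_lt => e e0.
have := gc _ _ (hx x) => /cvgrPdist_lt/(_ e e0) gh.
near=> n; rewrite mem_set; first by near: n.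
rewrite /A/= in_itv/= -ler_norml.
near: n; exact: nbhs_infty_ger.
Unshelve. all: by end_near. Qed.

End approximation_by_simple_maps.

Section convolution_theory.
Variables (R : realType) (X : completeNormedModType R[i]).
Local Notation T := (lebesgueType R).
Local Notation mu := (leb R).
Implicit Types (psi : R -> R[i]) (f : R -> X).

Local Notation cnorm z := (rnorm (z : R[i]^o)).

Lemma measurable_complex_simple psi :
  measurable_fun setT ((fun y => complex.Re (psi y)) : T -> R) ->
  measurable_fun setT ((fun y => complex.Im (psi y)) : T -> R) ->
  exists s : nat -> R -> R[i]^o, (forall n, simple_map (s n)) /\
    forall x, s n x @[n --> \oo] --> (psi x : R[i]^o).
Proof.
move=> /measurable_fun_real_simple[r [sr rx]].
move=> /measurable_fun_real_simple[j [sj jx]].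
exists (fun n x => (r n x +i* j n x)%C); split.
  move=> n; exact: (simple_map_comp (fun y : R * R => (y.1 +i* y.2)%C : R[i]^o)
    (simple_map_pair (sr n) (sj n))).
move=> x; apply/cvg_rnormP.
have rx0 : `|complex.Re (psi x) - r n x| @[n --> \oo] --> (0 : R).
  rewrite -(normr0 R) -(subrr (complex.Re (psi x))); apply: cvg_norm.
  by apply: cvgB => //; exact: cvg_cst.
have jx0 : `|complex.Im (psi x) - j n x| @[n --> \oo] --> (0 : R).
  rewrite -(normr0 R) -(subrr (complex.Im (psi x))); apply: cvg_norm.
  by apply: cvgB => //; exact: cvg_cst.
apply: (@squeeze_cvgr _ _ _ _ (cst 0) (fun n =>
   `|complex.Re (psi x) - r n x| + `|complex.Im (psi x) - j n x|)).
- apply: nearW => n; rewrite rnorm_ge0/=.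
  by apply: (le_trans (rnormc_le _)); case: (psi x).
- exact: cvg_cst.
- by rewrite -[X in _ --> X]addr0; exact: cvgD.
Qed.

Lemma measurable_cnorm psi :
  measurable_fun setT ((fun y => complex.Re (psi y)) : T -> R) ->
  measurable_fun setT ((fun y => complex.Im (psi y)) : T -> R) ->
  measurable_fun setT ((fun y => (cnorm (psi y))%:E) : T -> \bar R).
Proof.
move=> mr mi; have [s [ss sx]] := measurable_complex_simple mr mi.
apply: (@ae_cvg_measurable _ (fun n x => (cnorm (s n x))%:E)).
  move=> n; apply: simple_map_measurable.
  exact: (simple_map_comp (fun y : R[i]^o => (rnorm y)%:E) (ss n)).
apply: aeW => x; apply: cvg_EFin; first exact: nearW.
exact: cvg_rnorm (sx x).
Qed.

Lemma strongly_measurableZ psi f :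
  measurable_fun setT ((fun y => complex.Re (psi y)) : T -> R) ->
  measurable_fun setT ((fun y => complex.Im (psi y)) : T -> R) ->
  strongly_measurable f -> strongly_measurable (fun y => psi y *: f y).
Proof.
move=> mr mi [t [st ft]]; have [s [ss sx]] := measurable_complex_simple mr mi.
exists (fun n y => s n y *: t n y); split.
  move=> n; have /simple_functionP[stn too] := st n.
  apply/simple_functionP; split.
    exact: (simple_map_comp (fun y : R[i]^o * X => y.1 *: y.2)
      (simple_map_pair (ss n) stn)).
  apply: le_lt_trans too; apply: le_outer_measure => x /= st0 t0.
  by apply: st0; rewrite t0 scaler0.
by apply: aeS ft => x tx; apply: cvgZ => //; exact: sx.
Qed.

Lemma integrable_refl x (u : R -> R) :
  mu.-integrable setT (fun y => (u y)%:E) ->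
  mu.-integrable setT (fun y => (u (x - y))%:E).
Proof.
move=> /integrableP[m_ uoo]; apply/integrableP; split.
  exact: (measurable_fun_refl x m_).
have mn := measurableT_comp (@abse_measurable R setT) m_.
have := ge0_integral_refl x mn (fun y => abse_ge0 _).
by rewrite /comp => ->.
Qed.

Lemma complex_L1_refl x psi :
  complex_L1 psi -> complex_L1 (fun y => psi (x - y)).
Proof.
by move=> [ir ii]; split; [exact: (integrable_refl x ir)|exact: (integrable_refl x ii)].
Qed.

Lemma complex_L1_measurable psi : complex_L1 psi ->
  measurable_fun setT ((fun y => complex.Re (psi y)) : T -> R) /\
  measurable_fun setT ((fun y => complex.Im (psi y)) : T -> R).
Proof.
by move=> [ir ii]; split; apply/measurable_EFinP;
  [exact: measurable_int ir|exact: measurable_int ii].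
Qed.

Lemma complex_L1_cnorm psi : complex_L1 psi ->
  measurable_fun setT ((fun y => (cnorm (psi y))%:E) : T -> \bar R) /\
  (\int[mu]_y (cnorm (psi y))%:E < +oo)%E.
Proof.
move=> psiL; have [mr mi] := complex_L1_measurable psiL.
split; first exact: measurable_cnorm.
move: psiL => [/integrableP[mr' roo] /integrableP[mi' ioo]].
have mr1 := measurableT_comp (@abse_measurable R setT) mr'.
have mi1 := measurableT_comp (@abse_measurable R setT) mi'.
apply: (@le_lt_trans _ _ (\int[mu]_y
    (`|(complex.Re (psi y))%:E| + `|(complex.Im (psi y))%:E|))%E).
  apply: le_lower_integral => y _; first by rewrite lee_fin rnorm_ge0.
  by rewrite lee_fin rnormc_le.
rewrite (ge0_integralD mu measurableT (fun y _ => abse_ge0 _) mr1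
  (fun y _ => abse_ge0 _) mi1).
exact: lte_add_pinfty.
Qed.

Lemma integral_rnormZ_le psi f (M : R) : complex_L1 psi ->
  strongly_measurable f -> 0 <= M -> {ae mu, forall x, rnorm (f x) <= M} ->
  (\int[mu]_y (rnorm (psi y *: f y))%:E <=
   M%:E * \int[mu]_y (cnorm (psi y))%:E)%E.
Proof.
move=> psiL mf M0 fM; have [mr mi] := complex_L1_measurable psiL.
have [mp _] := complex_L1_cnorm psiL.
have p0 y : setT y -> (0 <= (cnorm (psi y))%:E)%E by rewrite lee_fin rnorm_ge0.
rewrite -(ge0_integralZl_EFin mu measurableT p0 mp M0).
apply: (ae_ge0_le_integral measurableT).
- by move=> y _; rewrite lee_fin rnorm_ge0.
- exact: (strongly_measurable_rnorm (strongly_measurableZ mr mi mf)).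
- by move=> y _; rewrite mule_ge0 ?lee_fin// rnorm_ge0.
- exact: measurable_funeM.
- by apply: aeS fM => y fy _; rewrite -EFinM lee_fin rnormZ mulrC ler_wpM2r ?rnorm_ge0.
Qed.

Lemma Linfty_bound f : Linfty f ->
  exists2 M : R, 0 <= M & {ae mu, forall x, rnorm (f x) <= M}.
Proof.
move=> [_ [M fM]]; exists (Num.max M 0); first by rewrite le_max lexx orbT.
by apply: aeS fM => x fx; rewrite le_max fx.
Qed.

Lemma convolution_integrand psi f x : complex_L1 psi -> Linfty f ->
  is_bochner_integral (fun y => psi (x - y) *: f y) (convolution psi f x).
Proof.
move=> psiL Lf; have [M M0 fM] := Linfty_bound Lf.
have pxL := complex_L1_refl x psiL.
have [mr mi] := complex_L1_measurable pxL.
have [_ poo] := complex_L1_cnorm pxL.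
have [|v pv] := is_bochner_integral_exists (strongly_measurableZ mr mi Lf.1).
  apply: (le_lt_trans (integral_rnormZ_le pxL Lf.1 M0 fM)).
  by rewrite lte_mul_pinfty ?lee_fin.
by rewrite /convolution (bochner_integralE pv).
Qed.

Lemma rnorm_convolution_le psi f : complex_L1 psi -> Linfty f ->
  exists2 C : R, 0 <= C & forall x, rnorm (convolution psi f x) <= C.
Proof.
move=> psiL Lf; have [M M0 fM] := Linfty_bound Lf.
have [mp poo] := complex_L1_cnorm psiL.
have I0 : (0 <= \int[mu]_y (cnorm (psi y))%:E)%E.
  by apply: integral_ge0 => y _; rewrite lee_fin rnorm_ge0.
exists (M * fine (\int[mu]_y (cnorm (psi y))%:E)).
  by rewrite mulr_ge0// fine_ge0.
move=> x; rewrite -lee_fin EFinM fineK ?ge0_fin_numE//.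
apply: (le_trans (rnorm_is_bochner_integral (convolution_integrand x psiL Lf))).
apply: (le_trans (integral_rnormZ_le (complex_L1_refl x psiL) Lf.1 M0 fM)).
rewrite (ge0_integral_refl x mp)// => y; first by rewrite lee_fin rnorm_ge0.
Qed.

Lemma complex_L1B psi1 psi2 : complex_L1 psi1 -> complex_L1 psi2 ->
  complex_L1 (fun y => psi1 y - psi2 y).
Proof.
move=> [r1 i1] [r2 i2]; split.
  have := integrableB measurableT r1 r2; apply: eq_integrable => // y _ /=.
  by rewrite -EFinB; case: (psi1 y); case: (psi2 y).
have := integrableB measurableT i1 i2; apply: eq_integrable => // y _ /=.
by rewrite -EFinB; case: (psi1 y); case: (psi2 y).
Qed.

(** The kernels at two points are translates of each other after a reflection, so
    that continuity of translation in L1 applies to the real and the imaginary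
    part of [psi]. *)
Lemma convolution_seq_continuous psi f (xs : nat -> R) (x : R) :
  complex_L1 psi -> Linfty f -> xs @ \oo --> x ->
  convolution psi f (xs n) @[n --> \oo] --> convolution psi f x.
Proof.
move=> psiL Lf xsx; have [M M0 fM] := Linfty_bound Lf.
pose d n := fun y => psi (x - y) - psi (xs n - y).
have dL n : complex_L1 (d n).
  exact: (complex_L1B (complex_L1_refl x psiL) (complex_L1_refl (xs n) psiL)).
pose dr n := (\int[mu]_y `|complex.Re (psi (xs n - y)) - complex.Re (psi (x - y))|%:E)%E.
pose di n := (\int[mu]_y `|complex.Im (psi (xs n - y)) - complex.Im (psi (x - y))|%:E)%E.
have [mr _] := integrable_L1_continuous psiL.1.
have [mi _] := integrable_L1_continuous psiL.2.
have ub n : ((rnorm (convolution psi f x - convolution psi f (xs n)))%:E <=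
    M%:E * (dr n + di n))%E.
  have bB := is_bochner_integralB (convolution_integrand x psiL Lf)
    (convolution_integrand (xs n) psiL Lf).
  apply: (le_trans (rnorm_is_bochner_integral bB)).
  under eq_integral do rewrite -scalerBl.
  apply: (le_trans (integral_rnormZ_le (dL n) Lf.1 M0 fM)).
  apply: lee_wpmul2l; first by rewrite lee_fin.
  have mdr := measurable_dist (measurable_fun_refl (xs n) mr) (measurable_fun_refl x mr).
  have mdi := measurable_dist (measurable_fun_refl (xs n) mi) (measurable_fun_refl x mi).
  rewrite /dr /di -(ge0_integralD mu measurableT _ mdr _ mdi); last 2 first.
  - by move=> y _; rewrite lee_fin.
  - by move=> y _; rewrite lee_fin.
  apply: le_lower_integral => y _; first by rewrite lee_fin rnorm_ge0.
  rewrite -EFinD lee_fin /= /refl rnorm_distC.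
  apply: (le_trans (rnormc_le _)).
  by case: (psi (xs n - y)) => a b; case: (psi (x - y)).
have cv : (M%:E * (dr n + di n))%E @[n --> \oo] --> 0%E.
  rewrite -[X in _ --> X](mule0 M%:E); apply: cvgeZl => //.
  rewrite -[X in _ --> X]adde0; apply: cvgeD => //.
    exact: L1_continuous_refl (integrable_L1_continuous psiL.1) xsx.
  exact: L1_continuous_refl (integrable_L1_continuous psiL.2) xsx.
apply/cvg_rnormP/cvgrPdist_lt => e e0.
apply: filterS (cvge0_near_lt cv e0) => n /(le_lt_trans (ub n)).
by rewrite sub0r normrN ger0_norm ?rnorm_ge0.
Qed.

Lemma Linfty_convolution psi f : complex_L1 psi -> Linfty f ->
  Linfty (convolution psi f).
Proof.
move=> psiL Lf; split.
  apply: seq_continuous_strongly_measurable => xs x.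
  exact: convolution_seq_continuous.
have [C C0 fC] := rnorm_convolution_le psiL Lf.
by exists C; apply: aeW.
Qed.

(** By invariance the translation moves from the kernel to [f], which leaves the
    same kernel in both integrals. *)
Lemma rnorm_convolution_diff psi f tau x : complex_L1 psi -> Linfty f ->
  ((rnorm (convolution psi f (x + tau) - convolution psi f x))%:E <=
   \int[mu]_y (cnorm (psi (x - y)%R) * rnorm (f (y + tau) - f y)%R)%:E)%E.
Proof.
move=> psiL Lf.
have b1 := is_bochner_integral_shift tau (convolution_integrand (x + tau) psiL Lf).
have bB := is_bochner_integralB b1 (convolution_integrand x psiL Lf).
apply: (le_trans (rnorm_is_bochner_integral bB)).
rewrite le_eqVlt; apply/orP; left; apply/eqP; apply: eq_integral => y _.
by rewrite opprD addrACA subrr addr0 -scalerBr rnormZ.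
Qed.

End convolution_theory.

(** * Variable exponents and Hoelder's inequality *)

Section modular.
Variable R : realType.
Local Notation T := (lebesgueType R).
Local Notation mu := (leb R).
Implicit Types (r s t : \bar R).

Lemma phi_exp_ge0 r t : (0 <= phi_exp r t)%E.
Proof.
by rewrite /phi_exp; case: r => [r||]; [exact: poweR_ge0| |]; case: ifP.
Qed.

Lemma le_phi_exp r s t : (1 <= r)%E -> (0 <= s)%E -> (s <= t)%E ->
  (phi_exp r s <= phi_exp r t)%E.
Proof.
move=> r1 s0 st; have t0 := le_trans s0 st.
case: r r1 => [r|_|//]; rewrite /phi_exp.
  rewrite lee_fin => r1; apply: gt0_ler_poweR => //.
  - by rewrite (le_trans _ r1).
  - by rewrite in_itv/= s0 ?leey.
  - by rewrite in_itv/= t0 ?leey.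
case: ifPn => [_|s1]; first by case: ifP.
by rewrite ifF//; apply/negbTE; apply: contraNN s1; exact: le_trans.
Qed.

Lemma phi_exp_le1 r t : (1 <= r)%E -> (0 <= t)%E -> (t <= 1)%E ->
  (phi_exp r t <= 1)%E.
Proof.
move=> r1 t0 t1; apply: (le_trans (le_phi_exp r1 t0 t1)).
by case: r r1 => [r||]// _; rewrite /phi_exp ?poweR1r ?lexx ?lee_fin ?ler01.
Qed.

(** Young's inequality.  For the conjugate pair (+oo, 1) the modular of [a] is
    infinite unless [a <= 1], in which case [a * b <= b]. *)
Lemma young_phi_exp r s (a b : R) : (1 <= r)%E -> (1 <= s)%E ->
  (r^-1 + s^-1 = 1)%E -> 0 <= a -> 0 <= b ->
  ((a * b)%:E <= phi_exp r a%:E + phi_exp s b%:E)%E.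
Proof.
move=> r1 s1 rs a0 b0; wlog : r s a b a0 b0 r1 s1 rs / (s <= r)%E.
  move=> H; have [sr|/ltW rs'] := leP s r; first exact: H.
  by rewrite addeC mulrC; apply: H => //; rewrite addeC.
case: r r1 rs => [r||//] r1; case: s s1 => [s||//] s1.
- move: r1 s1; rewrite !lee_fin => r1 s1.
  have r0 : 0 < r by rewrite (lt_le_trans _ r1).
  have s0 : 0 < s by rewrite (lt_le_trans _ s1).
  rewrite !inver !gt_eqF// -EFinD => -[rs] _.
  rewrite (le_trans (conjugate_powR a0 b0 r0 s0 rs))//.
  by apply: lerD; rewrite ler_pdivrMr// ler_peMr// powR_ge0.
- by rewrite leye_eq.
- move: s1; rewrite lee_fin => s1; rewrite invey add0e => ss _.
  have {ss} -> : s = 1.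
    move/eqP : ss; rewrite inve_eq1 eqe => /eqP //.
  rewrite /phi_exp poweRe1 ?lee_fin//; case: ifPn => a1.
    by rewrite add0e lee_fin ler_piMl.
  by rewrite addye// leey.
- by rewrite invey add0e => /eqP; rewrite eq_sym onee_eq0.
Qed.

Lemma measurable_phi_exp (p : R -> \bar R) (u : R -> R) : exponent p ->
  measurable_fun setT (u : T -> R) -> (forall x, 0 <= u x) ->
  measurable_fun setT ((fun x => phi_exp (p x) (u x)%:E) : T -> \bar R).
Proof.
move=> [mp p1] ms u0.
(* [w] is the power with finite exponent: as p >= 1, the value at 0 is 0. *)
pose w x : R := if u x == 0 then 0 else expR (fine (p x) * ln (u x)).
pose v x : \bar R := if u x <= 1 then 0%E else +oo%E.
have E : (fun x => phi_exp (p x) (u x)%:E) =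
    (fun x => if p x == +oo%E then v x else (w x)%:E).
  apply/funext => x; rewrite /v /w; move: (p1 x).
  case: (p x) => [r r1| _|//]; last by rewrite /= lee_fin.
  rewrite /= /powR; case: ifPn => // _; rewrite gt_eqF//.
  by move: r1; rewrite lee_fin; exact: lt_le_trans.
rewrite E.
have mv : measurable_fun setT (v : T -> \bar R).
  apply: measurable_fun_ifT; try exact: measurable_cst.
  by apply: measurable_fun_ler; [exact: ms|exact: measurable_cst].
have mw : measurable_fun setT ((fun x => (w x)%:E) : T -> \bar R).
  apply/measurable_EFinP; apply: measurable_fun_ifT.
  - by apply: measurable_fun_eqr; [exact: ms|exact: measurable_cst].
  - exact: measurable_cst.
  - apply: (measurableT_comp (@measurable_expR R)).
    apply: measurable_funM.
    + exact: (measurableT_comp (@fine_measurable R setT measurableT) mp).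
    + exact: (measurableT_comp (@measurable_ln R) ms).
apply: (measurable_fun_ifT _ mv mw).
by apply: measurable_fun_eqe; [exact: mp|exact: measurable_cst].
Qed.

End modular.

Section hoelder.
Variable R : realType.
Local Notation T := (lebesgueType R).
Local Notation mu := (leb R).

(** The constant 2 comes from bounding both terms of Young's inequality by
    their modulars.  The function [H], which need not be measurable, only enters
    through a measurable minorant [h]. *)
Lemma hoelder_Lp_norm (D : set R) (p q : R -> \bar R) (g h H : R -> R)
    (alpha : R) :
  measurable (D : set T) -> exponent p -> exponent q ->
  (forall x, ((p x)^-1 + (q x)^-1 = 1)%E) ->
  measurable_fun setT (g : T -> R) -> (forall x, 0 <= g x) ->
  measurable_fun setT (h : T -> R) -> (forall x, 0 <= h x) ->
  (forall x, h x <= H x) ->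
  0 < alpha -> (Lp_norm p D g <= alpha%:E)%E ->
  (\int[mu]_(x in D) (h x * g x)%:E <= (2 * alpha)%:E * Lp_norm q D H)%E.
Proof.
move=> mD ep eq_ pq mg g0 mh h0 hH a0 ga.
have young lam kap : 0 < lam -> 0 < kap ->
    (\int[mu]_(x in D) phi_exp (p x) (`|g x| / lam)%:E <= 1)%E ->
    (\int[mu]_(x in D) phi_exp (q x) (`|H x| / kap)%:E <= 1)%E ->
    (\int[mu]_(x in D) (h x * g x)%:E <= (2 * lam * kap)%:E)%E.
  move=> l0 k0 gl Hk.
  have gl0 x : 0 <= g x / lam by rewrite divr_ge0// ltW.
  have hk0 x : 0 <= h x / kap by rewrite divr_ge0// ltW.
  have mgl : measurable_fun setT ((fun x => g x / lam) : T -> R).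
    by apply: measurable_funM; [exact: mg|exact: measurable_cst].
  have mhk : measurable_fun setT ((fun x => h x / kap) : T -> R).
    by apply: measurable_funM; [exact: mh|exact: measurable_cst].
  have mp := @measurable_funTS _ _ T _ (D : set T) _ (measurable_phi_exp ep mgl gl0).
  have mq := @measurable_funTS _ _ T _ (D : set T) _ (measurable_phi_exp eq_ mhk hk0).
  apply: (@le_trans _ _ (\int[mu]_(x in D) ((lam * kap)%:E *
      (phi_exp (p x) (g x / lam)%:E + phi_exp (q x) (h x / kap)%:E)))%E).
    apply: le_lower_integral => x _; first by rewrite lee_fin mulr_ge0.
    rewrite (_ : h x * g x = (lam * kap) * (g x / lam * (h x / kap))); last first.
      by field; rewrite !gt_eqF.
    rewrite EFinM lee_pmul2l ?lte_fin ?mulr_gt0//.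
    exact: young_phi_exp (ep.2 x) (eq_.2 x) (pq x) (gl0 x) (hk0 x).
  have p0 x : D x -> (0 <= phi_exp (p x) (g x / lam)%:E)%E.
    by move=> _; exact: phi_exp_ge0.
  have q0 x : D x -> (0 <= phi_exp (q x) (h x / kap)%:E)%E.
    by move=> _; exact: phi_exp_ge0.
  have pq0 x : D x -> (0 <= phi_exp (p x) (g x / lam)%:E +
      phi_exp (q x) (h x / kap)%:E)%E.
    by move=> Dx; rewrite adde_ge0 ?p0 ?q0.
  rewrite (ge0_integralZl_EFin mu mD pq0 (emeasurable_funD mp mq)); last first.
    by rewrite mulr_ge0 ?ltW.
  rewrite (ge0_integralD mu mD p0 mp q0 mq).
  rewrite (_ : 2 * lam * kap = lam * kap * 2) ?EFinM; last by ring.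
  rewrite -EFinM lee_pmul2l ?lte_fin ?mulr_gt0//.
  rewrite -[2]/(1 + 1) EFinD; apply: leeD.
    apply: le_trans gl; apply: le_lower_integral => // x _.
    by rewrite ger0_norm.
  apply: le_trans Hk; apply: le_lower_integral => // x _.
  apply: (le_phi_exp (eq_.2 x)); rewrite ?lee_fin//.
  by rewrite ler_pM2r ?invr_gt0// (le_trans (hH x))// ler_norm.
(* The infimum over [lam] may fail to be attained, so it is approached. *)
have adh kap : 0 < kap ->
    (\int[mu]_(x in D) phi_exp (q x) (`|H x| / kap)%:E <= 1)%E ->
    (\int[mu]_(x in D) (h x * g x)%:E <= (2 * alpha * kap)%:E)%E.
  move=> k0 Hk; apply/lee_addgt0Pr => e e0.
  have d0 : 0 < e / (2 * kap) by rewrite divr_gt0// mulr_gt0.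
  have : (Lp_norm p D g < (alpha + e / (2 * kap))%:E)%E.
    by apply: (le_lt_trans ga); rewrite lte_fin ltrDl.
  move=> /ereal_inf_lt[_ [lam [l0 gl] <-]]; rewrite lte_fin => la.
  apply: (le_trans (young lam kap l0 k0 gl Hk)).
  rewrite -EFinD lee_fin.
  rewrite (_ : 2 * alpha * kap + e = 2 * (alpha + e / (2 * kap)) * kap); last first.
    by field; rewrite gt_eqF.
  by rewrite ler_pM2r// ler_pM2l// ltW.
rewrite -lee_pdivrMl ?mulr_gt0//.
apply: le_ereal_inf_tmp => _ [kap [k0 Hk] <-].
rewrite lee_pdivrMl ?mulr_gt0// -EFinM.
exact: adh.
Qed.

End hoelder.

(** * Convexity and Jensen's inequality *)

Section convexity.
Variables (R : realType) (phi : R -> R).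
Hypothesis phi_convex : convex_function (`[0, +oo[%classic : set R^o) phi.
Hypothesis phi_incr : {in `[0, +oo[ &, {homo phi : x y / x <= y}}.

Lemma convex_ge0P (t x y : R) : 0 <= t <= 1 -> 0 <= x -> 0 <= y ->
  phi (t * x + (1 - t) * y) <= t * phi x + (1 - t) * phi y.
Proof.
move=> /andP[t0 t1] x0 y0.
have xin : (x : R^o) \in `[0, +oo[%classic by rewrite inE/= in_itv/= x0.
have yin : (y : R^o) \in `[0, +oo[%classic by rewrite inE/= in_itv/= y0.
exact: (phi_convex (Itv01 t0 t1) xin yin).
Qed.

Lemma homo_ge0 (x y : R) : 0 <= x -> x <= y -> phi x <= phi y.
Proof.
move=> x0 xy; apply: phi_incr => //; rewrite in_itv/= andbT//.
exact: le_trans xy.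
Qed.

(** Slopes to the right of [b] dominate slopes to the left of [b], so the
    infimum of the former is the slope of a supporting line. *)
Lemma supporting_line (b : R) : 0 <= b ->
  exists2 m : R, 0 <= m & forall s, 0 <= s -> phi b + m * s <= phi s + m * b.
Proof.
rewrite le_eqVlt => /predU1P[<-|b0].
  by exists 0 => // s s0; rewrite !mul0r !addr0; exact: homo_ge0.
pose S := [set (phi s - phi b) / (s - b) | s in [set s | b < s]].
have S0 : S !=set0.
  exists ((phi (b + 1) - phi b) / (b + 1 - b)).
  by exists (b + 1) => //=; rewrite ltrDl.
have lb0 : lbound S 0.
  move=> _ [s /= bs <-]; apply: divr_ge0; last by rewrite subr_ge0 ltW.
  by rewrite subr_ge0; apply: homo_ge0; exact: ltW.
exists (inf S); first exact: lb_le_inf.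
move=> s s0; have [sb|bs|->//] := ltgtP s b; last first.
  have : inf S <= (phi s - phi b) / (s - b).
    by apply: ge_inf; [exists 0|exists s].
  by rewrite ler_pdivlMr ?subr_gt0//; lra.
suff : (phi b - phi s) / (b - s) <= inf S.
  by rewrite ler_pdivrMr ?subr_gt0//; lra.
apply: lb_le_inf => // _ [t /= bt <-].
have st : 0 < t - s by lra.
rewrite ler_pdivrMr ?subr_gt0// mulrAC ler_pdivlMr ?subr_gt0//.
(* [b] is the convex combination of [s] and [t] with these weights. *)
have := @convex_ge0P ((t - b) / (t - s)) s t.
rewrite (_ : 1 - (t - b) / (t - s) = (b - s) / (t - s)); last first.
  by field; rewrite gt_eqF.
rewrite (_ : (t - b) / (t - s) * s + (b - s) / (t - s) * t = b); last first.
  by field; rewrite gt_eqF.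
have tb01 : 0 <= (t - b) / (t - s) <= 1.
  by rewrite divr_ge0 ?ler_pdivrMr//=; lra.
have t0 : 0 <= t by lra.
move=> /(_ tb01 s0 t0).
rewrite [X in _ <= X](_ : _ = ((t - b) * phi s + (b - s) * phi t) / (t - s)); last first.
  by field; rewrite gt_eqF.
by rewrite ler_pdivlMr//; nra.
Qed.

Local Notation T := (lebesgueType R).

Lemma measurable_monotone_comp (u : R -> R) :
  measurable_fun setT (u : T -> R) -> (forall x, 0 <= u x) ->
  measurable_fun setT ((fun x => phi (u x)) : T -> R).
Proof.
move=> ms u0.
(* [phi] is monotone on the half-line only; truncation extends this to R. *)
have mphi : measurable_fun setT (fun x : R => phi (Num.max 0 x)).
  apply: nondecreasing_measurable => // x y xy.
  apply: homo_ge0; first by rewrite le_max lexx.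
  by rewrite ge_max le_max lexx/= le_max xy orbT.
have := measurableT_comp mphi ms.
by congr measurable_fun; apply/funext => x /=; rewrite max_r.
Qed.

End convexity.

Section blocks.
Variable R : realType.
Local Notation T := (lebesgueType R).
Local Notation mu := (leb R).

Lemma esumZl (I : choiceType) (S : set I) (c : R) (b : I -> \bar R) :
  0 <= c -> (forall i, 0 <= b i)%E ->
  (\esum_(i in S) (c%:E * b i) = c%:E * \esum_(i in S) b i)%E.
Proof.
rewrite le_eqVlt => /predU1P[<- _|c0 b0].
  by rewrite mul0e esum1// => i _; rewrite mul0e.
rewrite /esum -ereal_sup_pZl// -[RHS]/(ereal_sup _) image_comp.
congr ereal_sup; apply/seteqP; split=> _ [A FA <-]; exists A => //=.
  by rewrite ge0_mule_fsumr.
by rewrite -ge0_mule_fsumr.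
Qed.

(** The alternating bijection from [nat] to [int], which transports countable
    additivity from sequences to families indexed by [int]. *)
Definition int_enum (n : nat) : int := if odd n then Negz n./2 else Posz n./2.
Definition int_index (z : int) : nat :=
  match z with Posz m => m.*2 | Negz m => m.*2.+1 end.

Lemma int_indexK : cancel int_index int_enum.
Proof.
by case=> m; rewrite /int_enum/= odd_double/= ?uphalf_double ?doubleK.
Qed.

Lemma int_enumK : cancel int_enum int_index.
Proof.
move=> n; rewrite /int_enum /int_index.
by case: ifP => on; rewrite -[RHS](odd_double_half n) on.
Qed.

Lemma int_enum_bij : set_bij setT setT int_enum.
Proof.
split=> //; first by apply: in2W; exact: can_inj int_enumK.
by move=> z _; exists (int_index z) => //; exact: int_indexK.
Qed.

(** Countable subadditivity of the integral over a cover, obtained by making the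
    cover disjoint. *)
Lemma integral_le_esum (I : int -> set R) (g : R -> \bar R) :
  (forall k, measurable (I k : set T)) -> (forall y, exists k, I k y) ->
  measurable_fun setT (g : T -> \bar R) -> (forall y, 0 <= g y)%E ->
  (\int[mu]_y g y <= \esum_(k in [set: int]) \int[mu]_(y in I k) g y)%E.
Proof.
move=> mI cI mg g0.
rewrite (@reindex_esum R nat int setT setT int_enum _ int_enum_bij) -nneseries_esumT; last first.
  by move=> n; exact: integral_ge0.
pose G n := I (int_enum n).
have mG n : measurable (G n : set T) by exact: mI.
have GT : \bigcup_n G n = setT.
  apply/seteqP; split=> // y _; have [k Iky] := cI y.
  by exists (int_index k) => //; rewrite /G int_indexK.
have mD n : measurable (seqDU G n : set T) by exact: (seqDU_measurable mG).
rewrite -[X in integral mu X]GT seqDU_bigcup_eq.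
rewrite (@ge0_integral_bigcup _ T R mu (seqDU G) g mD); last 3 first.
- exact: (@measurable_funTS _ _ T _ _ g mg).
- by move=> y _.
- exact: trivIset_seqDU.
apply: lee_nneseries; first by move=> n _ _; exact: integral_ge0.
move=> n _; apply: (ge0_subset_integral _ (mD n) (mG n)).
- exact: (@measurable_funTS _ _ T _ _ g mg).
- by move=> y _.
- by move=> y [].
Qed.

Variables (phi : R -> R).
Hypothesis hphi : nneg_map phi.
Hypothesis phi_convex : convex_function (`[0, +oo[%classic : set R^o) phi.
Hypothesis phi_incr : {in `[0, +oo[ &, {homo phi : x y / x <= y}}.

(** Jensen's inequality for the density equal to [a k / l] on the block [I k],
    which has total mass 1: integrate the supporting line at the mean.  Overlaps
    between blocks only increase the right-hand side of [integral_le_esum], and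
    the slope of the supporting line is nonnegative. *)
Lemma jensen_blocks (I : int -> set R) (a : int -> R) (l : R) (u : R -> R) :
  0 < l -> (forall k, 0 < a k) -> (\esum_(k in [set: int]) (a k)%:E = 1)%E ->
  (forall k, measurable (I k : set T)) -> (forall k, mu (I k) = l%:E) ->
  (forall y, exists k, I k y) ->
  measurable_fun setT (u : T -> R) -> (forall y, 0 <= u y) ->
  (\int[mu]_y (u y)%:E < +oo)%E ->
  ((phi (fine (\int[mu]_y (u y)%:E) / l))%:E <=
   \esum_(k in [set: int]) ((a k * l^-1)%:E *
     \int[mu]_(y in I k) (phi ((a k)^-1 * u y))%:E))%E.
Proof.
move=> l0 a0 a1 mI Il cI ms u0 uoo.
set B := fine _ / l.
have Iu0 : (0 <= \int[mu]_y (u y)%:E)%E.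
  by apply: integral_ge0 => y _; rewrite lee_fin.
have B0 : 0 <= B by rewrite divr_ge0 ?fine_ge0// ltW.
have [m m0 sup] := supporting_line phi_convex phi_incr B0.
pose U k := (\int[mu]_(y in I k) (u y)%:E)%E.
pose P k := (\int[mu]_(y in I k) (phi ((a k)^-1 * u y))%:E)%E.
have U0 k : (0 <= U k)%E by apply: integral_ge0 => y _; rewrite lee_fin.
have au0 k y : 0 <= (a k)^-1 * u y by apply: mulr_ge0; rewrite ?invr_ge0 ?u0 ?ltW.
have P0 k : (0 <= P k)%E.
  by apply: integral_ge0 => y _; rewrite lee_fin hphi.
have phiB : 0 <= phi B by exact: hphi.
have mB0 : 0 <= m * B by rewrite mulr_ge0.
have ml0 : 0 <= m * l^-1 by rewrite mulr_ge0// invr_ge0 ltW.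
have block k : ((phi B)%:E * (a k)%:E + (m * l^-1)%:E * U k <=
    (a k * l^-1)%:E * P k + (m * B)%:E * (a k)%:E)%E.
  have mau : measurable_fun setT ((fun y => (a k)^-1 * u y) : T -> R).
    by apply: measurable_funM; [exact: measurable_cst|exact: ms].
  have mE := @measurable_funTS _ _ T _ (I k) _ (proj2 (measurable_EFinP setT _) ms).
  have mpE := @measurable_funTS _ _ T _ (I k) _
    (proj2 (measurable_EFinP setT _) (measurable_monotone_comp phi_incr mau (au0 k))).
  have mak0 : 0 <= m * (a k)^-1 by rewrite mulr_ge0// invr_ge0 ltW.
  have uE0 y : I k y -> (0 <= (u y)%:E)%E by rewrite lee_fin.
  have pE0 y : I k y -> (0 <= (phi ((a k)^-1 * u y))%:E)%E.
    by rewrite lee_fin hphi.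
  have H : ((phi B * l)%:E + (m * (a k)^-1)%:E * U k <= P k + (m * B * l)%:E)%E.
    have -> : ((phi B * l)%:E = \int[mu]_(y in I k) (cst (phi B)%:E) y)%E.
      by rewrite (integral_cst mu (mI k)) [X in (_ * X)%E](Il k).
    have -> : ((m * B * l)%:E = \int[mu]_(y in I k) (cst (m * B)%:E) y)%E.
      by rewrite (integral_cst mu (mI k)) [X in (_ * X)%E](Il k).
    rewrite /U -(ge0_integralZl_EFin mu (mI k) uE0 mE mak0).
    rewrite -(ge0_integralD mu (mI k) (f1 := cst (phi B)%:E)); last 4 first.
    - by move=> y _; rewrite lee_fin.
    - exact: measurable_cst.
    - by move=> y _; rewrite -EFinM lee_fin mulr_ge0.
    - exact: measurable_funeM.
    rewrite -(ge0_integralD mu (mI k) pE0 mpE); last 2 first.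
    - by move=> y _; rewrite lee_fin.
    - exact: measurable_cst.
    apply: le_lower_integral => y _; rewrite -EFinM -!EFinD lee_fin.
      by rewrite addr_ge0// mulr_ge0.
    by rewrite -mulrA; exact: sup.
  move: (U k) (U0 k) (P k) (P0 k) H => Uk Uk0 Pk Pk0 H.
  have c0 : 0 <= a k * l^-1 by rewrite mulr_ge0 ?invr_ge0 ?ltW.
  have cE : (0 <= (a k * l^-1)%:E)%E by rewrite lee_fin.
  have := lee_wpmul2l cE H.
  rewrite ge0_muleDr//; last 2 first.
  - by rewrite lee_fin mulr_ge0// ltW.
  - by rewrite mule_ge0.
  rewrite ge0_muleDr//; last by rewrite lee_fin mulr_ge0// ltW.
  rewrite muleA -!EFinM.
  rewrite (_ : a k * l^-1 * (phi B * l) = phi B * a k); last first.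
    by field; rewrite gt_eqF.
  rewrite (_ : a k * l^-1 * (m * (a k)^-1) = m * l^-1); last first.
    by field; rewrite !gt_eqF.
  by rewrite (_ : a k * l^-1 * (m * B * l) = m * B * a k)//; field; rewrite gt_eqF.
have aE0 k : (0 <= (a k)%:E)%E by rewrite lee_fin ltW.
have := @le_esum R int setT _ _ (fun k _ => block k).
rewrite esumD; last 2 first.
- by move=> k _; rewrite -EFinM lee_fin mulr_ge0// ltW.
- by move=> k _; rewrite mule_ge0.
rewrite esumD; last 2 first.
- by move=> k _; rewrite mule_ge0// lee_fin mulr_ge0 ?invr_ge0 ?ltW.
- by move=> k _; rewrite -EFinM lee_fin mulr_ge0// ltW.
rewrite !esumZl// a1 !mule1 => H.
rewrite -(@leeD2rE _ (m * B)%:E)//; apply: le_trans H.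
apply: leeD => //.
have -> : ((m * B)%:E = (m * l^-1)%:E * \int[mu]_y (u y)%:E)%E.
  rewrite -[X in (_ * X)%E]fineK ?ge0_fin_numE// -EFinM.
  by congr EFin; rewrite /B; ring.
apply: lee_wpmul2l; first by rewrite lee_fin.
apply: (integral_le_esum mI cI (proj2 (measurable_EFinP setT _) ms)) => y.
by rewrite lee_fin.
Qed.

End blocks.

(** * The estimate of the convolution *)

Section main_estimate.
Variables (R : realType) (X : completeNormedModType R[i]).
Local Notation T := (lebesgueType R).
Local Notation mu := (leb R).
Variables (phi vphi : R -> R).
Hypotheses (hphi : nneg_map phi) (hvphi : nneg_map vphi).
Hypothesis phi_convex : convex_function (`[0, +oo[%classic : set R^o) phi.
Hypothesis phi_incr : {in `[0, +oo[ &, {homo phi : x y / x <= y}}.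
Hypothesis phi_submul :
  forall x y, 0 <= x -> 0 <= y -> phi (x * y) <= vphi x * phi y.
Variables (p q : R -> \bar R).
Hypotheses (hp : exponent p) (hq : exponent q).
Hypothesis hpq : forall x, ((p x)^-1 + (q x)^-1 = 1)%E.
Variable F : R -> R -> R.
Hypothesis hF : pos_weight F.
Variable psi : R -> R[i].
Hypothesis hpsi : complex_L1 psi.
Variable a : int -> R.
Hypothesis ha : forall k, 0 < a k.
Hypothesis ha1 : (\esum_(k in [set: int]) (a k)%:E = 1)%E.
Variable f : R -> X.
Hypothesis hf : Linfty f.

Lemma measurable_rnorm_diff (g : R -> X) (tau : R) : strongly_measurable g ->
  measurable_fun setT ((fun x => rnorm (g (x + tau) - g x)) : T -> R).
Proof.
move=> mg; have [s gs] := strongly_measurable_shift tau mg.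
have [t gt] := mg.
by apply/measurable_EFinP; exact: simple_approx_measurable (simple_approxB gs gt).
Qed.

Lemma measurable_phi_diff (g : R -> X) (tau : R) : strongly_measurable g ->
  measurable_fun setT (phi_diff phi g tau : T -> R).
Proof.
move=> mg; apply: (measurable_monotone_comp phi_incr (measurable_rnorm_diff tau mg)).
by move=> x; exact: rnorm_ge0.
Qed.

Lemma phi_diff_ge0 (g : R -> X) (tau x : R) : 0 <= phi_diff phi g tau x.
Proof. exact/hphi/rnorm_ge0. Qed.

Lemma Lp_norm_ge0 (r : R -> \bar R) (D : set R) (u : R -> R) :
  (0 <= Lp_norm r D u)%E.
Proof.
by apply: le_ereal_inf_tmp => _ [lam [l0 _] <-]; rewrite lee_fin ltW.
Qed.

Lemma integral_kernel_diff_lty (x tau : R) :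
  (\int[mu]_y (rnorm (psi (x - y)%R : R[i]^o) * rnorm (f (y + tau) - f y)%R)%:E
     < +oo)%E.
Proof.
have [M M0 fM] := Linfty_bound hf.
have fMtau : {ae mu, forall y, rnorm (f (y + tau)) <= M}.
  have := ae_refl 0 (ae_refl tau fM).
  by apply: aeS => y; rewrite sub0r opprK addrC.
have m2 : strongly_measurable (fun y => f (y + tau) - f y).
  have [s gs] := strongly_measurable_shift tau hf.1; have [t gt] := hf.1.
  by eexists; exact: simple_approxB gs gt.
have fM2 : {ae mu, forall y, rnorm (f (y + tau) - f y) <= M + M}.
  apply: aeS2 fM fMtau => y fy fty.
  by apply: (le_trans (rnormB _ _)); exact: lerD.
have pL := complex_L1_refl x hpsi.
have := integral_rnormZ_le pL m2 (addr_ge0 M0 M0) fM2.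
under eq_integral do rewrite rnormZ.
move=> /le_lt_trans; apply.
by rewrite lte_mul_pinfty ?lee_fin ?addr_ge0// (complex_L1_cnorm pL).2.
Qed.

(** On one block, submultiplicativity bounds the integrand by a product to
    which Hoelder's inequality applies.  The quotient [h] is a measurable
    minorant of the first factor, which need not be measurable itself. *)
Lemma block_estimate (tau l x eps : R) (k : int) :
  0 < l -> 0 < eps -> (weyl_sup p phi F f tau l <= eps%:E)%E ->
  (\int[mu]_(y in `[(x - (k%:~R + 1) * l)%R, (x - k%:~R * l)%R])
     (phi ((a k)^-1 * (rnorm (psi (x - y)%R : R[i]^o) *
           rnorm (f (y + tau) - f y)%R)))%:E <=
   (2 * (eps / F l (x - (k%:~R + 1) * l)))%R%:E *
     kernel_norm psi a vphi q l x k)%E.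
Proof.
move=> l0 eps0 ws; set t := x - (k%:~R + 1) * l.
have tl : x - k%:~R * l = t + l by rewrite /t; ring.
have F0 : 0 < F l t by exact: hF.
pose N y := rnorm (f (y + tau) - f y).
pose w y := (a k)^-1 * rnorm (psi (x - y) : R[i]^o).
pose g := phi_diff phi f tau.
have N0 y : 0 <= N y by exact: rnorm_ge0.
have w0 y : 0 <= w y by rewrite mulr_ge0 ?rnorm_ge0// invr_ge0 ltW.
have wN0 y : 0 <= w y * N y by exact: mulr_ge0.
have mN : measurable_fun setT (N : T -> R) by exact: measurable_rnorm_diff hf.1.
have mw : measurable_fun setT (w : T -> R).
  apply: measurable_funM; first exact: measurable_cst.
  by apply/measurable_EFinP; exact: (complex_L1_cnorm (complex_L1_refl x hpsi)).1.
have mwN : measurable_fun setT ((fun y => w y * N y) : T -> R).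
  exact: measurable_funM.
have mg : measurable_fun setT (g : T -> R) by exact: measurable_phi_diff hf.1.
have g0 y : 0 <= g y by exact: phi_diff_ge0.
(* Where [g] vanishes, so does [phi (w y * N y)], and the power is 0 as well. *)
pose h y := phi (w y * N y) * g y `^ (-1).
have mh : measurable_fun setT (h : T -> R).
  apply: measurable_funM; first exact: (measurable_monotone_comp phi_incr mwN).
  exact: (measurableT_comp (measurable_powR (-1)) mg).
have h0 y : 0 <= h y by rewrite mulr_ge0 ?powR_ge0// hphi.
have sub y : phi (w y * N y) <= vphi (w y) * g y by exact: phi_submul.
have hH y : h y <= vphi (w y).
  rewrite /h powR_inv1//.
  have [gy0|gy0] := eqVneq (g y) 0; first by rewrite gy0 invr0 mulr0 hvphi.
  by rewrite ler_pdivrMr// lt_neqAle eq_sym gy0 g0.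
have hg y : phi ((a k)^-1 * (rnorm (psi (x - y) : R[i]^o) * N y)) = h y * g y.
  rewrite mulrA -/(w y) /h powR_inv1//.
  have [gy0|gy0] := eqVneq (g y) 0; last by rewrite mulfVK.
  rewrite gy0 mulr0; apply/eqP; rewrite eq_le hphi// andbT.
  by rewrite (le_trans (sub y))// gy0 mulr0.
under eq_integral do rewrite hg.
have mI : measurable (`[t, x - k%:~R * l]%classic : set T).
  by apply: lebesgue_set_of_borel; exact: measurable_itv.
apply: (hoelder_Lp_norm mI hp hq hpq mg g0 mh h0 hH); first by rewrite divr_gt0.
rewrite tl mulrC EFinM lee_pdivlMl//.
apply: le_trans ws; apply: ereal_sup_ubound; exists t => //.
Qed.

Lemma blocks_cover (l x y : R) : 0 < l ->
  exists k : int, y \in `[x - (k%:~R + 1) * l, x - k%:~R * l].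
Proof.
move=> l0; exists (Num.floor ((x - y) / l)).
have /andP[] := real_floor_itv (num_real ((x - y) / l)).
rewrite ler_pdivlMr// ltr_pdivrMr// intrD => lek ltk.
by rewrite in_itv/=; apply/andP; split; lra.
Qed.

(** The factor [vphi l] is the price for dividing the integral by [l], which
    turns it into the mean that Jensen's inequality needs. *)
Lemma phi_convolution_diff (tau l x eps : R) :
  0 < l -> 0 < eps -> (weyl_sup p phi F f tau l <= eps%:E)%E ->
  ((phi_diff phi (convolution psi f) tau x)%:E <=
   (vphi l * (eps * (2 * l^-1)))%:E * kernel_sum psi a vphi q F l x)%E.
Proof.
move=> l0 eps0 ws.
pose u y := rnorm (psi (x - y) : R[i]^o) * rnorm (f (y + tau) - f y).
have u0 y : 0 <= u y by rewrite mulr_ge0 ?rnorm_ge0.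
have uoo : (\int[mu]_y (u y)%:E < +oo)%E by exact: integral_kernel_diff_lty.
have ms : measurable_fun setT (u : T -> R).
  apply: measurable_funM; last exact: measurable_rnorm_diff hf.1.
  by apply/measurable_EFinP; exact: (complex_L1_cnorm (complex_L1_refl x hpsi)).1.
have Iu0 : (0 <= \int[mu]_y (u y)%:E)%E.
  by apply: integral_ge0 => y _; rewrite lee_fin.
pose J := fine (\int[mu]_y (u y)%:E).
have J0 : 0 <= J by exact: fine_ge0.
have dJ : rnorm (convolution psi f (x + tau) - convolution psi f x) <= J.
  rewrite -lee_fin fineK ?ge0_fin_numE//.
  exact: rnorm_convolution_diff.
pose I (k : int) : set R := `[x - (k%:~R + 1) * l, x - k%:~R * l]%classic.
have mI k : measurable (I k : set T).
  by apply: lebesgue_set_of_borel; exact: measurable_itv.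
have Il k : mu (I k) = l%:E.
  rewrite -[LHS]/(lebesgue_measure (I k)) lebesgue_measure_itv/= lte_fin.
  rewrite ifT; last by nra.
  by rewrite -EFinB; congr EFin; ring.
have cI y : exists k, I k y by exact: blocks_cover.
have jensen := jensen_blocks hphi phi_convex phi_incr l0 ha ha1 mI Il cI ms u0 uoo.
apply: (@le_trans _ _ (vphi l * phi (J / l))%:E).
  rewrite lee_fin; apply: (le_trans (homo_ge0 phi_incr (rnorm_ge0 _) dJ)).
  rewrite -{1}[J](@divfK _ l) ?gt_eqF// mulrC; apply: phi_submul; first exact: ltW.
  by rewrite divr_ge0// ltW.
rewrite EFinM (EFinM (vphi l)) -muleA.
apply: lee_wpmul2l; first by rewrite lee_fin hvphi// ltW.
apply: (le_trans jensen).
rewrite /kernel_sum -esumZl; last 2 first.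
- by rewrite mulr_ge0 ?mulr_ge0 ?invr_ge0 ?ltW.
- move=> k; apply: mule_ge0; first by apply: mule_ge0; rewrite ?Lp_norm_ge0// lee_fin ltW.
  by rewrite inve_ge0 lee_fin ltW// hF.
apply: le_esum => k _.
have F0 : 0 < F l (x - (k%:~R + 1) * l) by exact: hF.
have al0 : 0 <= a k * l^-1 by rewrite mulr_ge0 ?invr_ge0 ?ltW.
have alE : (0 <= (a k * l^-1)%:E)%E by rewrite lee_fin.
apply: (le_trans (lee_wpmul2l alE (block_estimate x k l0 eps0 ws))).
move: F0 (kernel_norm _ _ _ _ _ _ _); set Fk := F l _ => F0 K.
rewrite inver gt_eqF// (muleAC (a k)%:E) -(EFinM (a k)) !muleA -!EFinM.
rewrite (_ : a k * l^-1 * (2 * (eps / Fk)) = eps * (2 * l^-1) * (a k * Fk^-1))//.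
by field; rewrite !gt_eqF.
Qed.

Variables (p1 : R -> \bar R) (F1 : R -> R -> R).
Hypotheses (hp1 : exponent p1) (hF1 : pos_weight F1).

(** The number [eps / F1 l t] is admissible in the infimum defining the norm:
    dividing the previous estimate by it leaves exactly the argument of the
    modular in [kernel_bound]. *)
Lemma weyl_sup_convolution (tau l eps : R) :
  kernel_bound psi a vphi q p1 F F1 -> 0 < l -> 0 < eps ->
  (weyl_sup p phi F f tau l <= eps%:E)%E ->
  (weyl_sup p1 phi F1 (convolution psi f) tau l <= eps%:E)%E.
Proof.
move=> kb l0 eps0 ws; apply: ge_ereal_sup => _ [t _ <-].
have F10 : 0 < F1 l t by exact: hF1.
have lam0 : 0 < (F1 l t)^-1 * eps by rewrite mulr_gt0 ?invr_gt0.
rewrite -lee_pdivlMl// -EFinM.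
apply: ereal_inf_lbound; exists ((F1 l t)^-1 * eps) => //; split=> //.
apply: (le_trans _ (kb t l l0)); apply: le_lower_integral => x _.
  exact: phi_exp_ge0.
have d0 := phi_diff_ge0 (convolution psi f) tau x.
apply: (le_phi_exp (hp1.2 x)).
  by rewrite lee_fin divr_ge0// ltW.
rewrite ger0_norm// mulrC EFinM lee_pdivrMl//.
apply: (le_trans (phi_convolution_diff x l0 eps0 ws)).
rewrite muleA -EFinM.
rewrite (_ : vphi l * (eps * (2 * l^-1)) =
  (F1 l t)^-1 * eps * (2 * l^-1 * F1 l t * vphi l))//.
by field; rewrite !gt_eqF.
Qed.

(** A bounded function scaled below 1 has modular at most the measure of the
    compact set, whatever the exponent. *)
Lemma convolution_diff_locally_Lp : diff_locally_Lp p1 phi (convolution psi f).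
Proof.
move=> tau K cK.
have Lc := Linfty_convolution hpsi hf.
have mK : measurable (K : set T).
  by apply: lebesgue_set_of_borel; exact: compact_measurable.
split; first exact: (@measurable_funTS _ _ T _ _ _ (measurable_phi_diff tau Lc.1)).
have [C C0 cC] := rnorm_convolution_le hpsi hf.
have CC0 : 0 <= C + C by rewrite addr_ge0.
have dC x : phi_diff phi (convolution psi f) tau x <= phi (C + C).
  apply: (homo_ge0 phi_incr (rnorm_ge0 _)).
  by apply: (le_trans (rnormB _ _)); exact: lerD.
have P0 : 0 < phi (C + C) + 1 by rewrite ltr_wpDl// hphi.
exists (phi (C + C) + 1)^-1; first by rewrite invr_gt0.
apply: (@le_lt_trans _ _ (\int[mu]_(x in K) (cst 1%E) x)%E).
  apply: le_lower_integral => x _; first exact: phi_exp_ge0.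
  apply: (phi_exp_le1 (hp1.2 x)).
    by rewrite lee_fin mulr_ge0// invr_ge0 ltW.
  rewrite lee_fin ger0_norm ?phi_diff_ge0// mulrC ler_pdivrMr// mul1r.
  by rewrite (le_trans (dC x))// lerDl.
by rewrite (integral_cst mu mK) mul1e; exact: compact_finite_measure.
Qed.

Hypothesis hkb : kernel_bound psi a vphi q p1 F F1.

Lemma equi_weyl_ap_convolution :
  equi_weyl_ap p phi F f -> equi_weyl_ap p1 phi F1 (convolution psi f).
Proof.
move=> [_ ap]; split; first exact: convolution_diff_locally_Lp.
move=> eps eps0; have [l [L [l0 L0 tauI]]] := ap eps eps0.
exists l, L; split; [exact: l0|exact: L0|].
move=> I iI IL; have [tau Itau wt] := tauI I iI IL.
exists tau; first exact: Itau.
exact: (weyl_sup_convolution hkb l0 eps0 wt).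
Qed.

(** A limsup below [eps] bounds [weyl_sup] by [eps] for all large [l], and the
    estimate transfers the bound for each such [l] separately. *)
Lemma weyl_ap_convolution :
  weyl_ap p phi F f -> weyl_ap p1 phi F1 (convolution psi f).
Proof.
move=> [_ ap]; split; first exact: convolution_diff_locally_Lp.
move=> eps eps0; have e20 : 0 < eps / 2 by rewrite divr_gt0.
have [L L0 tauI] := ap _ e20.
exists L; first exact: L0.
move=> I iI IL; have [tau Itau wt] := tauI I iI IL.
exists tau; first exact: Itau.
have : (limf_esup (weyl_sup p phi F f tau) +oo%R < eps%:E)%E.
  by apply: (le_lt_trans wt); rewrite lte_fin ltr_pdivrMr//; lra.
move=> /ereal_inf_lt[_ [V Voo <-] Veps].
apply: (@le_trans _ _ (ereal_sup (weyl_sup p1 phi F1 (convolution psi f) tau @`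
    (V `&` [set l | 0 < l])))).
  apply: ereal_inf_lbound; exists (V `&` [set l | 0 < l]); last by [].
  by apply: filterI; [exact: Voo|exact: nbhs_pinfty_gt].
apply: ge_ereal_sup => _ [l [Vl /= l0] <-].
apply: (weyl_sup_convolution hkb l0 eps0); apply: le_trans (ltW Veps).
by apply: ereal_sup_ubound; exists l.
Qed.

End main_estimate.

Unset Implicit Arguments.

(** * Invariance of almost periodicity under convolution *)

Theorem proposition4p12 (R : realType) (X : completeNormedModType R[i])
  (phi vphi : R -> R)
  (hphi : nneg_map phi) (hvphi : nneg_map vphi)
  (phi_convex : convex_function (`[0, +oo[%classic : set R^o) phi)
  (phi_incr : {in `[0, +oo[ &, {homo phi : x y / x <= y}})
  (phi_submul : forall x y, 0 <= x -> 0 <= y -> phi (x * y) <= vphi x * phi y)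
  (p q : R -> \bar R) (hp : exponent p) (hq : exponent q)
  (hpq : forall x, ((p x)^-1 + (q x)^-1 = 1)%E)
  (F : R -> R -> R) (hF : pos_weight F)
  (psi : R -> R[i]) (hpsi : complex_L1 psi)
  (a : int -> R) (ha : forall k, 0 < a k)
  (ha1 : (\esum_(k in [set: int]) (a k)%:E = 1)%E)
  (f : R -> X) (hf : Linfty f) :
  (equi_weyl_ap p phi F f ->
    [/\ forall x, exists! v, is_bochner_integral (fun y => psi (x - y) *: f y) v,
        Linfty (convolution psi f) &
        forall (p1 : R -> \bar R) (F1 : R -> R -> R),
          exponent p1 -> pos_weight F1 ->
          kernel_bound psi a vphi q p1 F F1 ->
          equi_weyl_ap p1 phi F1 (convolution psi f)]) /\
  (weyl_ap p phi F f ->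
    [/\ forall x, exists! v, is_bochner_integral (fun y => psi (x - y) *: f y) v,
        Linfty (convolution psi f) &
        forall (p1 : R -> \bar R) (F1 : R -> R -> R),
          exponent p1 -> pos_weight F1 ->
          kernel_bound psi a vphi q p1 F F1 ->
          weyl_ap p1 phi F1 (convolution psi f)]).
Proof.
have wd x : exists! v, is_bochner_integral (fun y => psi (x - y) *: f y) v.
  have gx := convolution_integrand x hpsi hf.
  exists (convolution psi f x); split; first exact: gx.
  by move=> v; exact: is_bochner_integral_unique gx.
have Lg := Linfty_convolution hpsi hf.
split=> ap; split; [exact: wd|exact: Lg| |exact: wd|exact: Lg|].
  move=> p1 F1 hp1 hF1 hkb.
  exact: (equi_weyl_ap_convolution hphi hvphi phi_convex phi_incr phi_submul
    hp hq hpq hF hpsi ha ha1 hf hp1 hF1 hkb ap).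
move=> p1 F1 hp1 hF1 hkb.
exact: (weyl_ap_convolution hphi hvphi phi_convex phi_incr phi_submul
  hp hq hpq hF hpsi ha ha1 hf hp1 hF1 hkb ap).
Qed.
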